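(* Let $q\in(0,1)$ and $m,n\in\mathbb N$. There exists a unique inner product $(\,\cdot\,,\,\cdot\,)_F$ in $\mathbb C[\mathrm{Mat}_{m,n}]_q$ satisfying $$(1,1)_F=1,\qquad \Big(\frac{\partial P}{\partial z_a^\alpha},Q\Big)_F=(P,\,Q\cdot z_a^\alpha)_F$$ for all $P,Q\in\mathbb C[\mathrm{Mat}_{m,n}]_q$ and all $a=1,\dots,n$, $\alpha=1,\dots,m$.
   Context: Ground field $\mathbb C$, $q\in(0,1)$. An inner product is a positive definite Hermitian form, linear in the first argument. $\mathbb C[\mathrm{Mat}_{m,n}]_q$ is the unital algebra with generators $z_a^\alpha$, $a=1,\dots,n$, $\alpha=1,\dots,m$, and relations $$z_a^\alpha z_b^\beta=\begin{cases}q\,z_b^\beta z_a^\alpha,& a=b\ \&\ \alpha<\beta\ \text{ or }\ a<b\ \&\ \alpha=\beta,\\ z_b^\beta z_a^\alpha,& a<b\ \&\ \alpha>\beta,\\ z_b^\beta z_a^\alpha+(q-q^{-1})z_a^\beta z_b^\alpha,& a<b\ \&\ \alpha<\beta.\end{cases}$$ $\Lambda^1(\mathrm{Mat}_{m,n})_q$ is the $\mathbb C[\mathrm{Mat}_{m,n}]_q$-bimodule with generators $dz_a^\alpha$ and relations $$z_b^\beta\, dz_a^\alpha=\sum_{\alpha',\beta'=1}^m\sum_{a',b'=1}^n R_{\beta\alpha}^{\beta'\alpha'}R_{ba}^{b'a'}\,dz_{a'}^{\alpha'}\cdot z_{b'}^{\beta'},$$ where $R_{ba}^{b'a'}=q^{-1}$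 if $a=b=a'=b'$; $=1$ if $a\ne b$, $a=a'$, $b=b'$; $=q^{-1}-q$ if $a<b$, $a=b'$, $b=a'$; $=0$ otherwise (and the same formula for Greek indices). It is a free left $\mathbb C[\mathrm{Mat}_{m,n}]_q$-module with generators $dz_a^\alpha$. The map $z_a^\alpha\mapsto dz_a^\alpha$ extends to a linear operator $d:\mathbb C[\mathrm{Mat}_{m,n}]_q\to\Lambda^1(\mathrm{Mat}_{m,n})_q$ satisfying the Leibniz rule. The $q$-partial derivatives are defined by $$df=\sum_{a=1}^n\sum_{\alpha=1}^m\frac{\partial f}{\partial z_a^\alpha}\,dz_a^\alpha,\qquad f\in\mathbb C[\mathrm{Mat}_{m,n}]_q.$$ *)

(* Defs.v *)
From HB Require Import structures.
From mathcomp Require Import all_boot all_order all_algebra.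
From mathcomp Require Import boolp classical_sets reals.
From mathcomp Require Import complex ring.

Set Implicit Arguments.
Unset Strict Implicit.
Unset Printing Implicit Defensive.

Import Order.TTheory GRing.Theory Num.Theory.
Local Open Scope quotient_scope.
Local Open Scope ring_scope.

(* K[Mat_{m,n}]_q is built as the algebra presented by generators and
   relations: formal noncommutative expressions in the generators, modulo the
   smallest congruence that contains the axioms of unital associative
   K-algebras and the defining relations. In [zgen al a], [al] is the upper
   (Greek) index and [a] the lower (Latin) one; indices start at 0. *)
Section QuantumMatrices.
Context {K : fieldType}.
Variables (q : K) (m n : nat).

Inductive qterm : Type :=
  | QZ of 'I_m & 'I_n
  | QScal of K
  | QAdd of qterm & qterm
  | QMul of qterm & qterm.

Inductive qcong : qterm -> qterm -> Prop :=
  | qcong_refl x : qcong x x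
  | qcong_sym x y : qcong x y -> qcong y x
  | qcong_trans y x z : qcong x y -> qcong y z -> qcong x z
  | qcong_add x x' y y' :
      qcong x x' -> qcong y y' -> qcong (QAdd x y) (QAdd x' y')
  | qcong_mul x x' y y' :
      qcong x x' -> qcong y y' -> qcong (QMul x y) (QMul x' y')
  | qcong_addA x y z : qcong (QAdd x (QAdd y z)) (QAdd (QAdd x y) z)
  | qcong_addC x y : qcong (QAdd x y) (QAdd y x)
  | qcong_add0 x : qcong (QAdd (QScal 0) x) x
  | qcong_addN x : qcong (QAdd (QMul (QScal (-1)) x) x) (QScal 0)
  | qcong_mulA x y z : qcong (QMul x (QMul y z)) (QMul (QMul x y) z)
  | qcong_mul1l x : qcong (QMul (QScal 1) x) x
  | qcong_mul1r x : qcong (QMul x (QScal 1)) x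
  | qcong_mulDl x y z :
      qcong (QMul (QAdd x y) z) (QAdd (QMul x z) (QMul y z))
  | qcong_mulDr x y z :
      qcong (QMul x (QAdd y z)) (QAdd (QMul x y) (QMul x z))
  | qcong_scalD c e : qcong (QScal (c + e)) (QAdd (QScal c) (QScal e))
  | qcong_scalM c e : qcong (QScal (c * e)) (QMul (QScal c) (QScal e))
  | qcong_scalC c x : qcong (QMul (QScal c) x) (QMul x (QScal c))
  | qcong_rel_q (al be : 'I_m) (a b : 'I_n) :
      (a = b /\ (al < be)%N) \/ ((a < b)%N /\ al = be) ->
      qcong (QMul (QZ al a) (QZ be b))
            (QMul (QScal q) (QMul (QZ be b) (QZ al a)))
  | qcong_rel_comm (al be : 'I_m) (a b : 'I_n) :
      (a < b)%N -> (be < al)%N ->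
      qcong (QMul (QZ al a) (QZ be b)) (QMul (QZ be b) (QZ al a))
  | qcong_rel_cross (al be : 'I_m) (a b : 'I_n) :
      (a < b)%N -> (al < be)%N ->
      qcong (QMul (QZ al a) (QZ be b))
            (QAdd (QMul (QZ be b) (QZ al a))
                  (QMul (QScal (q - q^-1)) (QMul (QZ be a) (QZ al b)))).

HB.instance Definition _ := gen_eqMixin qterm.
HB.instance Definition _ := gen_choiceMixin qterm.

Definition qcongb (x y : qterm) : bool := `[< qcong x y >].

Lemma qcongb_equiv : equiv_class_of qcongb.
Proof.
split=> [x|x y|y x z].
- exact/asboolP/qcong_refl.
- by apply/asboolP/asboolP; apply: qcong_sym.
- by move=> /asboolP xy /asboolP yz; apply/asboolP/(qcong_trans xy).
Qed.

Canonical qcongb_equiv_rel := EquivRelPack qcongb_equiv.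

Definition qMat : Type := {eq_quot qcongb_equiv_rel}.
HB.instance Definition _ := Choice.on qMat.
HB.instance Definition _ := EqQuotient.on qMat.

Lemma qMat_eqP x y : qcong x y <-> \pi_qMat x = \pi_qMat y.
Proof.
by split=> [xy|/eqP]; [apply/eqP|]; rewrite eqmodE;
  [exact/asboolP|move/asboolP].
Qed.

Definition qmat_of (t : qterm) : qMat := \pi_qMat t.

Definition qm_scal (c : K) : qMat := qmat_of (QScal c).
Definition qm_add (f g : qMat) : qMat := qmat_of (QAdd (repr f) (repr g)).
Definition qm_mul (f g : qMat) : qMat := qmat_of (QMul (repr f) (repr g)).
Definition qm_opp (f : qMat) : qMat := qm_mul (qm_scal (-1)) f.
Definition qm_scale (c : K) (f : qMat) : qMat := qm_mul (qm_scal c) f.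

Lemma repr_qmat_of x : qcong (repr (qmat_of x)) x.
Proof. by apply/qMat_eqP; rewrite reprK. Qed.

Lemma qm_addE x y : qm_add (qmat_of x) (qmat_of y) = qmat_of (QAdd x y).
Proof. by apply/qMat_eqP/qcong_add; apply: repr_qmat_of. Qed.

Lemma qm_mulE x y : qm_mul (qmat_of x) (qmat_of y) = qmat_of (QMul x y).
Proof. by apply/qMat_eqP/qcong_mul; apply: repr_qmat_of. Qed.

Lemma qmatW (P : qMat -> Prop) : (forall x, P (qmat_of x)) -> forall f, P f.
Proof. by move=> Px f; rewrite -[f]reprK. Qed.

Lemma qm_addA : associative qm_add.
Proof.
by do 3!elim/qmatW=> ?; rewrite !qm_addE; apply/qMat_eqP/qcong_addA.
Qed.

Lemma qm_addC : commutative qm_add.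
Proof.
by do 2!elim/qmatW=> ?; rewrite !qm_addE; apply/qMat_eqP/qcong_addC.
Qed.

Lemma qm_add0 : left_id (qm_scal 0) qm_add.
Proof. by elim/qmatW=> ?; rewrite qm_addE; apply/qMat_eqP/qcong_add0. Qed.

Lemma qm_addN : left_inverse (qm_scal 0) qm_opp qm_add.
Proof.
elim/qmatW=> ?; rewrite /qm_opp qm_mulE qm_addE.
exact/qMat_eqP/qcong_addN.
Qed.

HB.instance Definition _ :=
  GRing.isZmodule.Build qMat qm_addA qm_addC qm_add0 qm_addN.

Lemma qm_mulA : associative qm_mul.
Proof.
by do 3!elim/qmatW=> ?; rewrite !qm_mulE; apply/qMat_eqP/qcong_mulA.
Qed.

Lemma qm_mul1l : left_id (qm_scal 1) qm_mul.
Proof. by elim/qmatW=> ?; rewrite qm_mulE; apply/qMat_eqP/qcong_mul1l. Qed.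

Lemma qm_mul1r : right_id (qm_scal 1) qm_mul.
Proof. by elim/qmatW=> ?; rewrite qm_mulE; apply/qMat_eqP/qcong_mul1r. Qed.

Lemma qm_mulDl : left_distributive qm_mul qm_add.
Proof.
do 3!elim/qmatW=> ?; rewrite !(qm_addE, qm_mulE).
exact/qMat_eqP/qcong_mulDl.
Qed.

Lemma qm_mulDr : right_distributive qm_mul qm_add.
Proof.
do 3!elim/qmatW=> ?; rewrite !(qm_addE, qm_mulE).
exact/qMat_eqP/qcong_mulDr.
Qed.

(* The augmentation killing the generators shows that 1 != 0. *)
Fixpoint qterm_aug (t : qterm) : K :=
  match t with
  | QZ _ _ => 0
  | QScal c => c
  | QAdd x y => qterm_aug x + qterm_aug y
  | QMul x y => qterm_aug x * qterm_aug y
  end.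

Lemma qterm_aug_cong x y : qcong x y -> qterm_aug x = qterm_aug y.
Proof.
elim=> //= {x y}.
- by move=> y x z _ -> _ ->.
- by move=> x x' y y' _ -> _ ->.
- by move=> x x' y y' _ -> _ ->.
- by move=> *; rewrite addrA.
- by move=> *; rewrite addrC.
- by move=> *; rewrite add0r.
- by move=> *; rewrite mulN1r addNr.
- by move=> *; rewrite mulrA.
- by move=> *; rewrite mul1r.
- by move=> *; rewrite mulr1.
- by move=> *; rewrite mulrDl.
- by move=> *; rewrite mulrDr.
- by move=> *; rewrite mulrC.
- by move=> *; rewrite !mulr0.
- by move=> *; rewrite !mulr0 addr0.
Qed.

Lemma qm_1neq0 : qm_scal 1 != 0 :> qMat.
Proof.
apply/eqP => /qMat_eqP /qterm_aug_cong /= /eqP.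
by rewrite oner_eq0.
Qed.

HB.instance Definition _ := GRing.Zmodule_isNzRing.Build qMat
  qm_mulA qm_mul1l qm_mul1r qm_mulDl qm_mulDr qm_1neq0.

Lemma qm_scaleA c e f : qm_scale c (qm_scale e f) = qm_scale (c * e) f.
Proof.
rewrite /qm_scale (_ : qm_scal (c * e) = qm_mul (qm_scal c) (qm_scal e)).
  by rewrite qm_mulA.
by rewrite qm_mulE; apply/qMat_eqP/qcong_scalM.
Qed.

Lemma qm_scaleDl f : {morph qm_scale^~ f : c e / c + e}.
Proof.
move=> c e; rewrite /qm_scale -[RHS]qm_mulDl; congr qm_mul.
by rewrite qm_addE; apply/qMat_eqP/qcong_scalD.
Qed.

HB.instance Definition _ := GRing.Zmodule_isLmodule.Build K qMat
  qm_scaleA qm_mul1l (fun c => qm_mulDr (qm_scal c)) qm_scaleDl.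

Lemma qm_scaleAl (c : K) (f g : qMat) : c *: (f * g) = (c *: f) * g.
Proof. exact: qm_mulA. Qed.

HB.instance Definition _ := GRing.Lmodule_isLalgebra.Build K qMat qm_scaleAl.

Lemma qm_scaleAr (c : K) (f g : qMat) : c *: (f * g) = f * (c *: g).
Proof.
rewrite -[LHS]/(qm_mul (qm_scal c) (qm_mul f g)) qm_mulA.
have -> : qm_mul (qm_scal c) f = qm_mul f (qm_scal c).
  by elim/qmatW: f => x; rewrite !qm_mulE; apply/qMat_eqP/qcong_scalC.
by rewrite -qm_mulA.
Qed.

HB.instance Definition _ := GRing.Lalgebra_isAlgebra.Build K qMat qm_scaleAr.

Definition zgen (al : 'I_m) (a : 'I_n) : qMat := qmat_of (QZ al a).

Lemma qmat_of_scal c : qmat_of (QScal c) = c%:A.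
Proof. exact: esym (qm_mul1r _). Qed.

Lemma qmat_ofD x y : qmat_of (QAdd x y) = qmat_of x + qmat_of y.
Proof. exact: esym (qm_addE _ _). Qed.

Lemma qmat_ofM x y : qmat_of (QMul x y) = qmat_of x * qmat_of y.
Proof. exact: esym (qm_mulE _ _). Qed.

Lemma qmat_of_eqP x y : qcong x y <-> qmat_of x = qmat_of y.
Proof. exact: qMat_eqP. Qed.

(* [Rmx b a b' a'] is R_{ba}^{b'a'}. *)
Definition Rmx (N : nat) (b a b' a' : 'I_N) : K :=
  if [&& a == b, a == a' & a == b'] then q^-1
  else if [&& a != b, a == a' & b == b'] then 1
  else if [&& (a < b)%N, a == b' & b == a'] then q^-1 - q
  else 0.

(* The bimodule of 1-forms, presented in the same way: formal expressions in
   the generators dz modulo the smallest congruence containing the axioms of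
   bimodules over the K-algebra [qMat] and the relations between zgen and dz. *)
Inductive oterm : Type :=
  | OZero
  | ODz of 'I_m & 'I_n
  | OAdd of oterm & oterm
  | OLeft of qMat & oterm
  | ORight of oterm & qMat.

Inductive ocong : oterm -> oterm -> Prop :=
  | ocong_refl u : ocong u u
  | ocong_sym u v : ocong u v -> ocong v u
  | ocong_trans v u w : ocong u v -> ocong v w -> ocong u w
  | ocong_add u u' v v' :
      ocong u u' -> ocong v v' -> ocong (OAdd u v) (OAdd u' v')
  | ocong_left f u u' : ocong u u' -> ocong (OLeft f u) (OLeft f u')
  | ocong_right f u u' : ocong u u' -> ocong (ORight u f) (ORight u' f)
  | ocong_addA u v w : ocong (OAdd u (OAdd v w)) (OAdd (OAdd u v) w)
  | ocong_addC u v : ocong (OAdd u v) (OAdd v u)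
  | ocong_add0 u : ocong (OAdd OZero u) u
  | ocong_addN u : ocong (OAdd (OLeft (-1) u) u) OZero
  | ocong_leftA f g u : ocong (OLeft f (OLeft g u)) (OLeft (f * g) u)
  | ocong_left1 u : ocong (OLeft 1 u) u
  | ocong_leftDr f u v :
      ocong (OLeft f (OAdd u v)) (OAdd (OLeft f u) (OLeft f v))
  | ocong_leftDl f g u :
      ocong (OLeft (f + g) u) (OAdd (OLeft f u) (OLeft g u))
  | ocong_rightA f g u : ocong (ORight (ORight u f) g) (ORight u (f * g))
  | ocong_right1 u : ocong (ORight u 1) u
  | ocong_rightDl f u v :
      ocong (ORight (OAdd u v) f) (OAdd (ORight u f) (ORight v f))
  | ocong_rightDr f g u :
      ocong (ORight u (f + g)) (OAdd (ORight u f) (ORight u g))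
  | ocong_leftright f g u :
      ocong (ORight (OLeft f u) g) (OLeft f (ORight u g))
  | ocong_scal (c : K) u : ocong (OLeft c%:A u) (ORight u c%:A)
  | ocong_rel (al be : 'I_m) (a b : 'I_n) :
      ocong (OLeft (zgen be b) (ODz al a))
            (\big[OAdd/OZero]_(al' < m) \big[OAdd/OZero]_(be' < m)
             \big[OAdd/OZero]_(a' < n) \big[OAdd/OZero]_(b' < n)
               OLeft (Rmx be al be' al' * Rmx b a b' a')%:A
                     (ORight (ODz al' a') (zgen be' b'))).

HB.instance Definition _ := gen_eqMixin oterm.
HB.instance Definition _ := gen_choiceMixin oterm.

Definition ocongb (u v : oterm) : bool := `[< ocong u v >].

Lemma ocongb_equiv : equiv_class_of ocongb.
Proof.
split=> [u|u v|v u w].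
- exact/asboolP/ocong_refl.
- by apply/asboolP/asboolP; apply: ocong_sym.
- by move=> /asboolP uv /asboolP vw; apply/asboolP/(ocong_trans uv).
Qed.

Canonical ocongb_equiv_rel := EquivRelPack ocongb_equiv.

Definition Omega1 : Type := {eq_quot ocongb_equiv_rel}.
HB.instance Definition _ := Choice.on Omega1.
HB.instance Definition _ := EqQuotient.on Omega1.

Definition omega_of (u : oterm) : Omega1 := \pi_Omega1 u.

Lemma omega_of_eqP u v : ocong u v <-> omega_of u = omega_of v.
Proof.
by split=> [uv|/eqP]; [apply/eqP|]; rewrite eqmodE;
  [exact/asboolP|move/asboolP].
Qed.

Definition om_add (u v : Omega1) := omega_of (OAdd (repr u) (repr v)).
Definition om_left (f : qMat) (u : Omega1) := omega_of (OLeft f (repr u)).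
Definition om_opp (u : Omega1) := om_left (-1) u.

(* The right action of [qMat] on 1-forms; the left one is the scaling [*:]. *)
Definition rmul (u : Omega1) (f : qMat) := omega_of (ORight (repr u) f).

Lemma repr_omega_of u : ocong (repr (omega_of u)) u.
Proof. by apply/omega_of_eqP; rewrite /omega_of reprK. Qed.

Lemma om_addE u v : om_add (omega_of u) (omega_of v) = omega_of (OAdd u v).
Proof. by apply/omega_of_eqP/ocong_add; apply: repr_omega_of. Qed.

Lemma om_leftE f u : om_left f (omega_of u) = omega_of (OLeft f u).
Proof. by apply/omega_of_eqP/ocong_left; apply: repr_omega_of. Qed.

Lemma rmulE u f : rmul (omega_of u) f = omega_of (ORight u f).
Proof. by apply/omega_of_eqP/ocong_right; apply: repr_omega_of. Qed.

Lemma omegaW (P : Omega1 -> Prop) :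
  (forall u, P (omega_of u)) -> forall w, P w.
Proof. by move=> Pu w; rewrite -[w]reprK. Qed.

Lemma om_addA : associative om_add.
Proof.
by do 3!elim/omegaW=> ?; rewrite !om_addE; apply/omega_of_eqP/ocong_addA.
Qed.

Lemma om_addC : commutative om_add.
Proof.
by do 2!elim/omegaW=> ?; rewrite !om_addE; apply/omega_of_eqP/ocong_addC.
Qed.

Lemma om_add0 : left_id (omega_of OZero) om_add.
Proof. by elim/omegaW=> ?; rewrite om_addE; apply/omega_of_eqP/ocong_add0. Qed.

Lemma om_addN : left_inverse (omega_of OZero) om_opp om_add.
Proof.
elim/omegaW=> ?; rewrite /om_opp om_leftE om_addE.
exact/omega_of_eqP/ocong_addN.
Qed.

HB.instance Definition _ :=
  GRing.isZmodule.Build Omega1 om_addA om_addC om_add0 om_addN.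

Lemma om_leftA f g w : om_left f (om_left g w) = om_left (f * g) w.
Proof.
by elim/omegaW: w => ?; rewrite !om_leftE; apply/omega_of_eqP/ocong_leftA.
Qed.

Lemma om_left1 : left_id 1 om_left.
Proof.
by elim/omegaW=> ?; rewrite om_leftE; apply/omega_of_eqP/ocong_left1.
Qed.

Lemma om_leftDr : right_distributive om_left +%R.
Proof.
move=> f; do 2!elim/omegaW=> ?; rewrite -[_ + _]/(om_add _ _).
rewrite -[RHS]/(om_add _ _) !(om_addE, om_leftE).
exact/omega_of_eqP/ocong_leftDr.
Qed.

Lemma om_leftDl w : {morph om_left^~ w : f g / f + g}.
Proof.
elim/omegaW: w => ? f g; rewrite -[RHS]/(om_add _ _) !om_leftE om_addE.
exact/omega_of_eqP/ocong_leftDl.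
Qed.

HB.instance Definition _ := GRing.Zmodule_isLmodule.Build qMat Omega1
  om_leftA om_left1 om_leftDr om_leftDl.

Definition dz (al : 'I_m) (a : 'I_n) : Omega1 := omega_of (ODz al a).

Lemma omega_of0 : omega_of OZero = 0. Proof. by []. Qed.

Lemma omega_ofD u v : omega_of (OAdd u v) = omega_of u + omega_of v.
Proof. exact: esym (om_addE _ _). Qed.

Lemma omega_of_left f u : omega_of (OLeft f u) = f *: omega_of u.
Proof. exact: esym (om_leftE _ _). Qed.

Lemma omega_of_right u f : omega_of (ORight u f) = rmul (omega_of u) f.
Proof. by rewrite rmulE. Qed.

Definition omega_ofE :=
  (omega_of0, omega_ofD, omega_of_left, omega_of_right).

Lemma rmulA u f g : rmul (rmul u f) g = rmul u (f * g).
Proof.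
elim/omegaW: u => u; rewrite -!omega_of_right.
exact/omega_of_eqP/ocong_rightA.
Qed.

Lemma rmul1 u : rmul u 1 = u.
Proof.
elim/omegaW: u => u; rewrite -omega_of_right.
exact/omega_of_eqP/ocong_right1.
Qed.

Lemma rmulDl u v f : rmul (u + v) f = rmul u f + rmul v f.
Proof.
elim/omegaW: u => u; elim/omegaW: v => v.
rewrite -omega_ofD -!omega_of_right -omega_ofD.
exact/omega_of_eqP/ocong_rightDl.
Qed.

Lemma rmulDr u f g : rmul u (f + g) = rmul u f + rmul u g.
Proof.
elim/omegaW: u => u; rewrite -!omega_of_right -omega_ofD.
exact/omega_of_eqP/ocong_rightDr.
Qed.

Lemma rmulZ f u g : rmul (f *: u) g = f *: rmul u g.
Proof.
elim/omegaW: u => u.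
have := (omega_of_eqP _ _).1 (ocong_leftright f g u).
by rewrite !(omega_of_left, omega_of_right).
Qed.

Lemma rmul_scal u (c : K) : rmul u c%:A = c%:A *: u.
Proof.
elim/omegaW: u => u; rewrite -omega_of_left -omega_of_right.
exact/esym/omega_of_eqP/ocong_scal.
Qed.

Lemma rmul0l f : rmul 0 f = 0.
Proof. by apply: (addrI (rmul 0 f)); rewrite -rmulDl !addr0. Qed.

Lemma rmul0r u : rmul u 0 = 0.
Proof. by apply: (addrI (rmul u 0)); rewrite -rmulDr !addr0. Qed.

Lemma z_dz (al be : 'I_m) (a b : 'I_n) :
  zgen be b *: dz al a =
  \sum_(al' < m) \sum_(be' < m) \sum_(a' < n) \sum_(b' < n)
    (Rmx be al be' al' * Rmx b a b' a')%:A *: rmul (dz al' a') (zgen be' b').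
Proof.
have /omega_of_eqP := ocong_rel al be a b; rewrite omega_of_left => ->.
pose om_big := big_morph _ omega_ofD omega_of0.
rewrite om_big; apply: eq_bigr => al' _; rewrite om_big.
apply: eq_bigr => be' _; rewrite om_big; apply: eq_bigr => a' _.
by rewrite om_big; apply: eq_bigr => b' _; rewrite !omega_ofE.
Qed.

Lemma RmxE (N : nat) (b a b' a' : 'I_N) :
  Rmx b a b' a' =
    (if a == b then q^-1 else 1) *+ ((a' == a) && (b' == b)) +
    (if (a < b)%N then q^-1 - q else 0) *+ ((a' == b) && (b' == a)).
Proof.
rewrite /Rmx ![a' == _]eq_sym ![b' == _]eq_sym.
case: (eqVneq a b) => [<-|neq_ab] /=; last first.
  case: (eqVneq a a') => [<-|_] /=.
    by rewrite [b == a]eq_sym (negPf neq_ab) /= !andbF mulr0n addr0; case: eqP.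
  by rewrite mulr0n add0r; case: ltnP; case: eqP; case: eqP.
by rewrite ltnn mul0rn addr0; case: eqP; case: eqP.
Qed.

Lemma sum_Rmx (N : nat) (b a : 'I_N) (F : 'I_N -> 'I_N -> Omega1) :
  \sum_a' \sum_b' (Rmx b a b' a')%:A *: F a' b' =
  (if a == b then q^-1 else 1)%:A *: F a b +
  (if (a < b)%N then q^-1 - q else 0)%:A *: F b a.
Proof.
have sum1 (c : K) i j : \sum_a' \sum_b'
    (c *+ ((a' == i) && (b' == j)))%:A *: F a' b' = c%:A *: F i j.
  rewrite (bigD1 i) //= [X in _ + X]big1 ?addr0 => [|k /negPf ne_k].
    rewrite (bigD1 j) //= [X in _ + X]big1 ?addr0 ?eqxx // => k /negPf ne_k.
    by rewrite ne_k andbF mulr0n !scale0r.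
  by rewrite big1 // => l _; rewrite ne_k mulr0n !scale0r.
rewrite -!sum1 -big_split; apply: eq_bigr => a' _.
rewrite -big_split; apply: eq_bigr => b' _.
by rewrite RmxE !scalerDl.
Qed.

Lemma z_dzE (al be : 'I_m) (a b : 'I_n) :
  zgen be b *: dz al a =
  (if al == be then q^-1 else 1)%:A *:
    ((if a == b then q^-1 else 1)%:A *: rmul (dz al a) (zgen be b) +
     (if (a < b)%N then q^-1 - q else 0)%:A *: rmul (dz al b) (zgen be a)) +
  (if (al < be)%N then q^-1 - q else 0)%:A *:
    ((if a == b then q^-1 else 1)%:A *: rmul (dz be a) (zgen al b) +
     (if (a < b)%N then q^-1 - q else 0)%:A *: rmul (dz be b) (zgen al a)).
Proof.
rewrite z_dz -!(sum_Rmx b a (fun a' b' => rmul (dz _ a') (zgen _ b'))).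
rewrite -(sum_Rmx be al (fun al' be' => \sum_a' \sum_b' (Rmx b a b' a')%:A *:
  rmul (dz al' a') (zgen be' b'))).
apply: eq_bigr => al' _; apply: eq_bigr => be' _.
rewrite scaler_sumr; apply: eq_bigr => a' _.
rewrite scaler_sumr; apply: eq_bigr => b' _.
by rewrite scalerA -scalerAl mul1r scalerA.
Qed.

Context (q0 : q != 0).

Fixpoint dterm (t : qterm) : Omega1 :=
  match t with
  | QZ al a => dz al a
  | QScal _ => 0
  | QAdd x y => dterm x + dterm y
  | QMul x y => rmul (dterm x) (qmat_of y) + qmat_of x *: dterm y
  end.

Lemma scalAE (c e : K) (u : Omega1) : c%:A *: (e%:A *: u) = (c * e)%:A *: u.
Proof. by rewrite scalerA -scalerAl mul1r scalerA. Qed.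

Lemma dterm_cong x y : qcong x y -> dterm x = dterm y.
Proof.
elim=> //= {x y}.
- by move=> y x t _ -> _ ->.
- by move=> x x' y y' _ -> _ ->.
- by move=> x x' y y' /qmat_of_eqP -> -> /qmat_of_eqP -> ->.
- by move=> *; rewrite addrA.
- by move=> *; rewrite addrC.
- by move=> *; rewrite add0r.
- by move=> x; rewrite rmul0l add0r qmat_of_scal !scaleN1r addNr.
- move=> x y t.
  by rewrite !qmat_ofM rmulDl rmulA rmulZ scalerDr scalerA addrA.
- by move=> x; rewrite rmul0l add0r qmat_of_scal !scale1r.
- by move=> x; rewrite scaler0 addr0 qmat_of_scal scale1r rmul1.
- by move=> x y t; rewrite rmulDl qmat_ofD scalerDl addrACA.
- by move=> x y t; rewrite scalerDr qmat_ofD rmulDr addrACA.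
- by move=> c e; rewrite addr0.
- by move=> c e; rewrite rmul0l scaler0 addr0.
- move=> c x.
  by rewrite rmul0l scaler0 add0r addr0 qmat_of_scal rmul_scal.
- move=> al be a b; rewrite rmul0l add0r qmat_of_scal -!/(zgen _ _) !z_dzE.
  have q_ring : q + (1 - q * q) / q = q^-1 by field.
  case=> [[<- lt_ab]|[lt_ab <-]]; rewrite !eqxx !ltnn -!val_eqE /=.
    rewrite (ltn_eqF lt_ab) (gtn_eqF lt_ab) lt_ab ltnNge (ltnW lt_ab) /=.
    rewrite !(scale0r, scale1r, addr0, scaler0, scalerDr, scalAE) mulrBr.
    by rewrite divff // addrCA -!scalerDl q_ring !scale1r.
  rewrite (ltn_eqF lt_ab) (gtn_eqF lt_ab) lt_ab ltnNge (ltnW lt_ab) /=.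
  rewrite !(scale0r, scale1r, addr0, scaler0, scalerDr, scalAE).
  rewrite mulr0 divff // mul1r !scale0r addr0 !scale1r addrCA -!scalerDl.
  by rewrite [q + _]addrC subrK.
- move=> al be a b lt_ab lt_al; rewrite -!/(zgen _ _) !z_dzE -!val_eqE /=.
  rewrite (ltn_eqF lt_ab) (gtn_eqF lt_ab) (ltn_eqF lt_al) (gtn_eqF lt_al).
  rewrite lt_ab lt_al [(b < a)%N]ltnNge [(al < be)%N]ltnNge
    (ltnW lt_ab) (ltnW lt_al) /=.
  by rewrite !(scale0r, scale1r, addr0, scaler0, scalerDr, scalAE) addrCA.
- move=> al be a b lt_ab lt_al; rewrite rmul0l add0r qmat_of_scal -!/(zgen _ _).
  rewrite !z_dzE -!val_eqE /=.
  rewrite (ltn_eqF lt_ab) (gtn_eqF lt_ab) (ltn_eqF lt_al) (gtn_eqF lt_al).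
  rewrite lt_ab lt_al [(b < a)%N]ltnNge [(be < al)%N]ltnNge
    (ltnW lt_ab) (ltnW lt_al) /=.
  rewrite !(scale0r, scale1r, addr0, add0r, scaler0, scalerDr, scalAE).
  rewrite -[q - q^-1]opprB mulNr !scaleNr -!opprD.
  set X := _ *: rmul (dz al b) _; set Y := _ *: rmul (dz be a) _.
  rewrite -[rmul _ _ + X + _]addrA [X + (Y + _)]addrCA.
  by set N := Y + _; rewrite addrA addrK addrC.
Qed.

(* [dterm] need not respect the defining relations when q = 0, hence the
   hypothesis on q in the lemmas about [qdiff]. *)
Definition qdiff (f : qMat) : Omega1 := dterm (repr f).

Lemma qdiff_qmat_of t : qdiff (qmat_of t) = dterm t.
Proof. exact: dterm_cong (repr_qmat_of t). Qed.

Lemma qdiff_z al a : qdiff (zgen al a) = dz al a.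
Proof. exact: qdiff_qmat_of. Qed.

Lemma qdiffD f g : qdiff (f + g) = qdiff f + qdiff g.
Proof.
by elim/qmatW: f => x; elim/qmatW: g => y; rewrite -qmat_ofD !qdiff_qmat_of.
Qed.

Lemma qdiffM f g : qdiff (f * g) = rmul (qdiff f) g + f *: qdiff g.
Proof.
by elim/qmatW: f => x; elim/qmatW: g => y; rewrite -qmat_ofM !qdiff_qmat_of.
Qed.

Lemma qdiffZ (c : K) f : qdiff (c *: f) = c%:A *: qdiff f.
Proof.
rewrite -[f in LHS]mul1r scalerAl qdiffM -qmat_of_scal qdiff_qmat_of /=.
by rewrite rmul0l add0r.
Qed.

Lemma qdiff_unique (D : qMat -> Omega1) :
    (forall f g, D (f + g) = D f + D g) ->
    (forall (c : K) f, D (c *: f) = c%:A *: D f) ->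
    (forall f g, D (f * g) = rmul (D f) g + f *: D g) ->
    (forall al a, D (zgen al a) = dz al a) ->
  D =1 qdiff.
Proof.
move=> DD DZ DM Dz; elim/qmatW=> t; rewrite qdiff_qmat_of.
have D1 : D 1 = 0.
  by apply: (addrI (D 1)); rewrite addr0 -{3}[1]mulr1 DM rmul1 scale1r.
elim: t => [al a|c|x IHx y IHy|x IHx y IHy] /=.
- exact: Dz.
- by rewrite qmat_of_scal DZ D1 scaler0.
- by rewrite qmat_ofD DD IHx IHy.
- by rewrite qmat_ofM DM IHx IHy.
Qed.

(* Matrix of coefficients of [qdiff f] in the generators dz. They exist when
   q != 0 ([qgradP] below, so that the default value 0 of [xget] is not used)
   and are unique because [Omega1] is a free left module on the dz. *)
Definition qgrad (f : qMat) : 'M[qMat]_(m, n) :=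
  xget 0 [set g : 'M[qMat]_(m, n) |
    qdiff f = \sum_(al < m) \sum_(a < n) g al a *: dz al a]%classic.

Definition qpartial (al : 'I_m) (a : 'I_n) (f : qMat) : qMat := qgrad f al a.

Definition dz_span (u : Omega1) : Prop := exists g : 'M[qMat]_(m, n),
  u = \sum_(al < m) \sum_(a < n) g al a *: dz al a.

Lemma dz_spanD u v : dz_span u -> dz_span v -> dz_span (u + v).
Proof.
move=> [g ->] [h ->]; exists (g + h).
rewrite -big_split; apply: eq_bigr => al _; rewrite -big_split.
by apply: eq_bigr => a _; rewrite mxE scalerDl.
Qed.

Lemma dz_spanZ f u : dz_span u -> dz_span (f *: u).
Proof.
move=> [g ->]; exists (\matrix_(al, a) (f * g al a)).
rewrite scaler_sumr; apply: eq_bigr => al _; rewrite scaler_sumr.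
by apply: eq_bigr => a _; rewrite mxE scalerA.
Qed.

Lemma dz_span0 : dz_span 0.
Proof.
exists 0; rewrite big1 // => al _; rewrite big1 // => a _.
by rewrite mxE scale0r.
Qed.

Lemma dz_span_sum I (r : seq I) (F : I -> Omega1) :
  (forall i, dz_span (F i)) -> dz_span (\sum_(i <- r) F i).
Proof. by move=> sF; apply: big_ind => //; [exact: dz_span0|exact: dz_spanD]. Qed.

Lemma dz_span_dz al a : dz_span (dz al a).
Proof.
exists (delta_mx al a).
rewrite (bigD1 al) //= [X in _ + X]big1 ?addr0 => [|k /negPf ne_k].
  rewrite (bigD1 a) //= [X in _ + X]big1 ?addr0 => [|k /negPf ne_k].
    by rewrite mxE !eqxx scale1r.
  by rewrite mxE ne_k andbF scale0r.
by rewrite big1 // => l _; rewrite mxE ne_k scale0r.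
Qed.

Lemma dz_spanDl (c : K) u v :
  c != 0 -> dz_span v -> dz_span (c%:A *: u + v) -> dz_span u.
Proof.
move=> c0 sv suv; have -> : u = c^-1%:A *: ((c%:A *: u + v) + (-1) *: v).
  by rewrite scaleN1r addrK scalAE mulVf // !scale1r.
exact/dz_spanZ/dz_spanD/dz_spanZ.
Qed.

Lemma dz_span_rmul_z al be a b : dz_span (rmul (dz al a) (zgen be b)).
Proof.
have rho0 (t : bool) : (if t then q^-1 else 1) != 0.
  by case: t; rewrite ?invr_eq0 ?oner_eq0.
have span1 (al' be' : 'I_m) (a' b' : 'I_n) : (be' <= al')%N -> (b' <= a')%N ->
    dz_span (rmul (dz al' a') (zgen be' b')).
  move=> le_al le_a; have := dz_spanZ (zgen be' b') (dz_span_dz al' a').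
  rewrite z_dzE [(al' < _)%N]ltnNge le_al [(a' < _)%N]ltnNge le_a /=.
  rewrite [0%:A]scale0r !scale0r !addr0 => sp.
  apply: (@dz_spanDl _ _ 0 (rho0 (a' == b')) dz_span0); rewrite addr0.
  apply: (@dz_spanDl _ _ 0 (rho0 (al' == be')) dz_span0); rewrite addr0.
  exact: sp.
have span2 (al' be' : 'I_m) (a' b' : 'I_n) : (be' <= al')%N ->
    dz_span (rmul (dz al' a') (zgen be' b')).
  move=> le_al; have [le_a|lt_a] := leqP b' a'; first exact: span1.
  have := dz_spanZ (zgen be' b') (dz_span_dz al' a').
  rewrite z_dzE [(al' < _)%N]ltnNge le_al /= lt_a [0%:A]scale0r !scale0r !addr0 => sp.
  apply: (@dz_spanDl _ _ _ (rho0 (a' == b'))); last first.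
    apply: (@dz_spanDl _ _ 0 (rho0 (al' == be')) dz_span0); rewrite addr0.
    exact: sp.
  exact/dz_spanZ/span1/ltnW.
have [le_al|lt_al] := leqP be al; first exact: span2.
have step (a' b' : 'I_n) : dz_span ((if (a' < b')%N then q^-1 - q else 0)%:A *:
    rmul (dz al b') (zgen be a')) -> dz_span (rmul (dz al a') (zgen be b')).
  move=> sW; have := dz_spanZ (zgen be b') (dz_span_dz al a').
  rewrite z_dzE lt_al => sp.
  apply: (dz_spanDl (rho0 (a' == b')) sW).
  apply: (dz_spanDl (rho0 (al == be)) _ sp).
  by apply/dz_spanZ/dz_spanD; apply/dz_spanZ/span2/ltnW.
have span3 (a' b' : 'I_n) :
    (b' <= a')%N -> dz_span (rmul (dz al a') (zgen be b')).
  move=> le_a; apply: step; rewrite ltnNge le_a /= [0%:A]scale0r scale0r.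
  exact: dz_span0.
have [le_a|lt_a] := leqP b a; first exact: span3.
exact/step/dz_spanZ/span3/ltnW.
Qed.

Lemma dz_span_rmul u f : dz_span u -> dz_span (rmul u f).
Proof.
elim/qmatW: f => t; elim: t u => [be b|c|x IHx y IHy|x IHx y IHy] u su.
- have big_rmul f :=
    big_morph (rmul^~ f) (fun v w => rmulDl v w f) (rmul0l f).
  case: su => g ->; rewrite big_rmul.
  apply: dz_span_sum => al; rewrite big_rmul.
  apply: dz_span_sum => a; rewrite rmulZ.
  exact/dz_spanZ/dz_span_rmul_z.
- by rewrite qmat_of_scal rmul_scal; apply: dz_spanZ.
- by rewrite qmat_ofD rmulDr; apply: dz_spanD; [apply: IHx|apply: IHy].
- by rewrite qmat_ofM -rmulA; apply/IHy/IHx.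
Qed.

Lemma dz_span_qdiff f : dz_span (qdiff f).
Proof.
elim/qmatW: f => t; rewrite qdiff_qmat_of.
elim: t => [al a|c|x sx y sy|x sx y sy] /=.
- exact: dz_span_dz.
- exact: dz_span0.
- exact: dz_spanD.
- by apply: dz_spanD; [apply: dz_span_rmul|apply: dz_spanZ].
Qed.

Lemma qgradP f :
  qdiff f = \sum_(al < m) \sum_(a < n) qpartial al a f *: dz al a.
Proof. exact: xgetPex (dz_span_qdiff f). Qed.

End QuantumMatrices.

(* Leibniz equality of inner products is pointwise equality. *)
Lemma dot_ext (K : numDomainType) (U : lmodType K) (theta : K -> K)
    (F G : {dot U for theta}) : F =2 G -> F = G.
Proof.
case: F G => f [[m1] [m2 m3 m4 m5] [m6]] [g [[p1] [p2 p3 p4 p5] [p6]]] /= fg.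
have {fg} efg : f = g by apply/funext => u; apply/funext => v; exact: fg.
subst g; rewrite (Prop_irrelevance m1 p1) (Prop_irrelevance m2 p2).
rewrite (Prop_irrelevance m3 p3) (Prop_irrelevance m4 p4).
by rewrite (Prop_irrelevance m5 p5) (Prop_irrelevance m6 p6).
Qed.

(* Main.v *)
Require Import Defs.
From HB Require Import structures.
From mathcomp Require Import all_boot all_order all_algebra.
From mathcomp Require Import boolp classical_sets functions fsbigop.
From mathcomp Require Import reals complex ring zify.

(** The required identity says that the q-derivative along a generator is
    adjoint to right multiplication by that generator.  Moving generators one at
    a time from the second argument to the first, and using that the derivatives
    of 1 vanish, determines all the values of the form; this is
    [fock_form_unique].

    For existence, right multiplications are represented by operators on a
    pre-Hilbert space.  Suppose that operators [Z j b] satisfy the relations of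
    the generators in the opposite order, that their adjoints [D i k] are moved
    across them by the rule that the q-derivatives obey (the Wick relation,
    [wick]), and that all the [D i k] kill a unit vector.  Let [Phi f] be the
    result of applying [f], evaluated at [Z], to that vector.  Then [Phi] turns
    right multiplication by z into [Z] and the q-derivatives into [D], so the inner
    product of [Phi f] and [Phi g] has the required property.  It is positive
    semidefinite for free, and definite as soon as [Phi] is injective.

    The operators come from m n independent q-oscillators.  Three oscillator
    operators form a 2 by 2 quantum unitary matrix; embed it in the identity
    matrix of size m + n at two consecutive rows, as a Givens rotation, and
    multiply m n such rotations, one per oscillator, so that each of m horizontal
    lines crosses each of n vertical ones.  The exchange relations ([RTT] between
    the entries of the product U, [crossrel] between U and the matrix V of the
    adjoints, and the unitarity of the columns) are stable under products of
    matrices with mutually commuting entries, so they need to be checked for a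
    single rotation only.  The upper left m by n block of U, with suitably
    rescaled rows, gives [Z], and that of V gives [D]: unitarity of the columns
    trades the sum over the lower rows in [crossrel] for a sum over the upper rows
    and a constant, which is the inhomogeneous term of the Wick relation.  An entry
    of V in this block is a sum over lattice paths with at least one
    annihilation, and therefore kills the vacuum.

    Injectivity of [Phi] is proved by ordering the generators.  Every element
    spanned by the words in the generators from w on is a polynomial in w, with
    coefficients on the left which are spanned by words in later generators.  On
    such polynomials [D] at w acts as the one-variable q-derivative, so
    iterating it extracts the leading coefficient, and one concludes by
    induction.

    It remains to know that the q-derivatives, defined by coefficients in the
    bimodule of 1-forms, are carried to [D].  Injectivity of [Phi] gives a gradient
    [grad] with [Phi (grad f i k) = D i k (Phi f)].  Its Leibniz rule expresses the
    right action of an expression t on [grad f] by values of [grad] that only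
    depend on the class of t in the algebra; since the gradients of the generators
    form a basis, the right action descends to the algebra.  Hence matrices over
    the algebra form a model of the bimodule, in which the dz are independent,
    and the coefficients of df in the dz are the entries of [grad f]. *)

Set Implicit Arguments.
Unset Strict Implicit.
Unset Printing Implicit Defensive.

Import Order.TTheory GRing.Theory Num.Theory.
Local Open Scope ring_scope.

(** * Exchange relations of quantum unitary matrices *)

Lemma lin4P (K : pzRingType) (W : lmodType K) (u v w t : W) : exists l : K -> K -> K -> K -> W,
  [/\ [/\ u = l 1 0 0 0, v = l 0 1 0 0, w = l 0 0 1 0 & t = l 0 0 0 1],
  forall e a b c d, e *: l a b c d = l (e * a) (e * b) (e * c) (e * d),
  forall a b c d a' b' c' d',
    l a b c d + l a' b' c' d' = l (a + a') (b + b') (c + c') (d + d') &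
  forall a b c d, - l a b c d = l (- a) (- b) (- c) (- d)].
Proof.
exists (fun a b c d => (a *: u + b *: v) + (c *: w + d *: t)); split=> [|*|*|*].
- by split; rewrite !scale1r !scale0r ?addr0 ?add0r.
- by rewrite !scalerDr !scalerA.
- by rewrite !scalerDl addrACA; congr (_ + _); exact: addrACA.
- by rewrite !scaleNr !opprD.
Qed.

(** Proves an identity between linear combinations of four given vectors by
    comparing coefficients: the existential lemma above hides the vectors behind
    an opaque function of their coefficients. *)
Ltac lin4 u v w t :=
  let l := fresh "l" in let Eu := fresh in let Ev := fresh in
  let Ew := fresh in let Et := fresh in
  let lZ := fresh in let lD := fresh in let lN := fresh in
  have [l [[Eu Ev Ew Et] lZ lD lN]] := lin4P u v w t;
  rewrite ?Eu ?Ev ?Ew ?Et ?(lZ, lD, lN); congr l; rewrite /=; field.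

Ltac lin2 u v := lin4 u v (0 *: u) (0 *: u).

Section QuantumMatrixRelations.
Context {K : fieldType} {E : algType K}.
Variable q : K.
Local Notation mu := (q - q^-1).
Local Notation grid := (nat -> nat -> E).

Definition qdiag (b : bool) : K := if b then q else 1.
Definition qoff (b : bool) : K := if b then mu else 0.

Definition gridmul N (X Y : grid) : grid := fun i k => \sum_(a < N) X i a * Y a k.

Definition grid_comm (X Y : grid) := forall i j k l : nat, GRing.comm (X i j) (Y k l).

(** The relation R T1 T2 = T2 T1 R for the Hecke R-matrix.  With the
    products read in the opposite order, these are the defining relations of the
    quantum matrix algebra. *)
Definition RTT (T : grid) := forall i j k l : nat,
  qdiag (i == j) *: (T i k * T j l) + qoff (i < j)%N *: (T j k * T i l) =
  qdiag (k == l) *: (T j l * T i k) + qoff (l < k)%N *: (T j k * T i l).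

Lemma gridmul_mul N (X X' Y Y' : grid) i j k l : grid_comm X' Y ->
  gridmul N X Y i k * gridmul N X' Y' j l =
  \sum_(a < N) \sum_(b < N) (X i a * X' j b) * (Y a k * Y' b l).
Proof.
move=> cXY; rewrite mulr_suml; apply: eq_bigr => a _.
rewrite mulr_sumr; apply: eq_bigr => b _.
by rewrite !mulrA -[X i a * _ * _]mulrA -[Y _ _ * _]cXY mulrA.
Qed.

(** In R X1 Y1 X2 Y2 the factors Y1 and X2 commute, so R can be moved through
    the X part and then through the Y part. *)
Lemma RTT_mul N (X Y : grid) :
  grid_comm X Y -> RTT X -> RTT Y -> RTT (gridmul N X Y).
Proof.
move=> cXY hX hY i j k l; rewrite !gridmul_mul //.
pose S F := \sum_(a < N) \sum_(b < N) (F a b : E).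
have SE (c e : K) F G : c *: S F + e *: S G = S (fun a b => c *: F a b + e *: G a b).
  rewrite !scaler_sumr -big_split; apply: eq_bigr => a _.
  by rewrite !scaler_sumr -big_split.
have eqS F G : (forall a b : 'I_N, F a b = G a b) -> S F = S G.
  by move=> FG; apply: eq_bigr => a _; apply: eq_bigr.
have Sswap F : S F = S (fun a b => F b a) by exact: exchange_big.
have SD F G : S (fun a b => F a b + G a b) = S F + S G.
  by rewrite /S -big_split; apply: eq_bigr => a _; rewrite -big_split.
rewrite [LHS](SE _ _ (fun a b => X i a * X j b * (Y a k * Y b l))
  (fun a b => X j a * X i b * (Y a k * Y b l))).
rewrite [RHS](SE _ _ (fun a b => X j a * X i b * (Y a l * Y b k))
  (fun a b => X j a * X i b * (Y a k * Y b l))) [RHS]Sswap.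
transitivity (S (fun a b =>
    qdiag (a == b) *: (X j b * X i a * (Y a k * Y b l)) +
    qoff (b < a)%N *: (X j a * X i b * (Y a k * Y b l)))).
  apply: eqS => a b; rewrite !(scalerAl _ (_ * _) (_ * _)) -!mulrDl.
  by congr (_ * _); exact: hX.
rewrite [LHS](SD (fun a b => qdiag (a == b) *: (X j b * X i a * (Y a k * Y b l)))
  (fun a b => qoff (b < a)%N *: (X j a * X i b * (Y a k * Y b l)))).
rewrite [X in _ + X]Sswap -SD; apply: eqS => a b.
rewrite !(scalerAr _ (_ * _) (_ * _)) -!mulrDr; congr (_ * _); exact: hY.
Qed.

(** The exchange relation between a quantum unitary matrix U and the matrix V of
    the adjoints of its entries.  A partial transpose of the R-matrix acts on
    the rows on the left-hand side, where it involves the rows below, and on the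
    columns on the right-hand side, where it involves the columns to the left. *)
Definition crossrel N (U V : grid) := forall i j k b : nat,
  (i < N)%N -> (j < N)%N -> (k < N)%N -> (b < N)%N ->
  qdiag (i == j) *: (V i k * U j b) +
    qoff (i == j) *: \sum_(l < N | (i < l)%N) V l k * U l b =
  qdiag (k == b) *: (U j b * V i k) +
    qoff (k == b) *: \sum_(a < N | (a < b)%N) U j a * V i a.

(** The column operator produced by the first factor is the transpose of the row
    operator which the relation for the second factor consumes: this is the
    exchange of the two triangular sums. *)
Lemma crossrel_mul N (X X' Y Y' : grid) :
  grid_comm X Y' -> grid_comm X' Y ->
  crossrel N X X' -> crossrel N Y Y' ->
  crossrel N (gridmul N X Y) (gridmul N X' Y').
Proof.
move=> cXY' cX'Y hX hY i j k b iN jN kN bN.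
pose S F := \sum_(a < N) \sum_(c < N) (F a c : E).
have eqS F G : (forall a b : 'I_N, F a b = G a b) -> S F = S G.
  by move=> FG; apply: eq_bigr => a _; apply: eq_bigr.
have SD F G : S (fun a b => F a b + G a b) = S F + S G.
  by rewrite /S -big_split; apply: eq_bigr => a _; rewrite -big_split.
have SZ (c : K) F : c *: S F = S (fun a b => c *: F a b).
  by rewrite scaler_sumr; apply: eq_bigr => a _; rewrite scaler_sumr.
have SS (P : pred 'I_N) (F : 'I_N -> 'I_N -> 'I_N -> E) :
    \sum_(l | P l) S (F l) = S (fun a c => \sum_(l | P l) F l a c).
  by rewrite exchange_big; apply: eq_bigr => a _; rewrite exchange_big.
have mulVU i' j' k' b' : gridmul N X' Y' i' k' * gridmul N X Y j' b' =
    S (fun a c => (X' i' a * X j' c) * (Y' a k' * Y c b')).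
  exact: gridmul_mul.
have mulUV i' j' k' b' : gridmul N X Y j' b' * gridmul N X' Y' i' k' =
    S (fun a c => (X j' c * X' i' a) * (Y c b' * Y' a k')).
  by rewrite gridmul_mul //; exact: exchange_big.
rewrite mulVU mulUV; under eq_bigr do rewrite mulVU.
under [in RHS]eq_bigr do rewrite mulUV.
rewrite !SS !SZ -!SD.
transitivity (S (fun a c => qdiag (a == c) *: (X j c * X' i a) * (Y' a k * Y c b) +
    qoff (a == c) *: (\sum_(e < N | (e < c)%N) X j e * X' i e) * (Y' a k * Y c b))).
  apply: eqS => a c; rewrite -mulrDl -(hX i j a c) // mulrDl -!scalerAl.
  by congr (_ + _ *: _); rewrite mulr_suml.
transitivity (S (fun a c => (X j c * X' i a) *
    (qdiag (k == b) *: (Y c b * Y' a k) +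
     qoff (k == b) *: \sum_(e < N | (e < b)%N) Y c e * Y' a e))); last first.
  apply: eqS => a c; rewrite mulrDr -!scalerAr; congr (_ + _ *: _).
  by rewrite mulr_sumr.
rewrite SD.
have -> : S (fun a c => qoff (a == c) *:
      (\sum_(e < N | (e < c)%N) X j e * X' i e) * (Y' a k * Y c b)) =
    S (fun a c => (X j c * X' i a) *
      (qoff (a == c) *: \sum_(l < N | (a < l)%N) Y' l k * Y l b)).
  have diagS (F : 'I_N -> 'I_N -> E) : (forall a c, a != c -> F a c = 0) ->
      S F = \sum_(a < N) F a a.
    move=> F0; apply: eq_bigr => a _; rewrite (bigD1 a) //= big1 ?addr0 // => c.
    by rewrite eq_sym => /F0.
  rewrite !diagS; first last.
  - by move=> a c; rewrite -val_eqE => /negPf->; rewrite scale0r mul0r.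
  - by move=> a c; rewrite -val_eqE => /negPf->; rewrite scale0r mulr0.
  under eq_bigr do rewrite eqxx -scalerAl mulr_suml.
  under [in RHS]eq_bigr do rewrite eqxx -scalerAr mulr_sumr.
  rewrite -!scaler_sumr; congr (_ *: _).
  by rewrite (exchange_big_dep predT).
rewrite -SD; apply: eqS => a c.
by rewrite -(hY a c k b) // mulrDr -scalerAl scalerAr.
Qed.

Definition colunit N (U V : grid) := forall k b : nat, (k < N)%N -> (b < N)%N ->
  \sum_(l < N) V l k * U l b = (k == b)%:R.

Lemma colunit_mul N (X X' Y Y' : grid) :
  grid_comm X Y' -> colunit N X X' -> colunit N Y Y' ->
  colunit N (gridmul N X Y) (gridmul N X' Y').
Proof.
move=> cXY' hX hY k b kN bN.
under eq_bigr do rewrite gridmul_mul //.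
rewrite exchange_big -(hY k b) //; apply: eq_bigr => a _.
rewrite exchange_big (bigD1 a) //= [X in _ + X]big1 ?addr0 => [|c ca].
  by rewrite -mulr_suml hX // eqxx mul1r.
by rewrite -mulr_suml hX // val_eqE eq_sym (negPf ca) mul0r.
Qed.

Definition grid_cons (X : grid) : grid := fun i j =>
  match i, j with i'.+1, j'.+1 => X i' j' | 0%N, 0%N => 1 | _, _ => 0 end.

Lemma RTT_cons (X : grid) : RTT X -> RTT (grid_cons X).
Proof.
move=> hX [|i] [|j] [|k] [|l] /=;
  rewrite ?(mulr0, mul0r, mulr1, mul1r, scaler0, scale0r, addr0, add0r, eqxx, eqSS, ltnS) //.
Qed.

Lemma colunit_cons N (U V : grid) :
  colunit N U V -> colunit N.+1 (grid_cons U) (grid_cons V).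
Proof.
move=> hU [|k] [|b] kN bN; rewrite big_ord_recl /=;
  rewrite ?(mulr0, mul0r, mulr1, mul1r, addr0, add0r).
- by rewrite big1 ?addr0 // => i _; rewrite mul0r.
- by rewrite big1 // => i _; rewrite mul0r.
- by rewrite big1 // => i _; rewrite mulr0.
- exact: hU.
Qed.

Lemma sum_if0 N : ((forall F : 'I_N -> E, \sum_i 0 * F i = 0) *
   (forall F : 'I_N -> E, \sum_i F i * 0 = 0) *
   (forall (P : pred 'I_N) (F : 'I_N -> E), \sum_i (if P i then 0 * F i else 0) = 0) *
   (forall (P : pred 'I_N) (F : 'I_N -> E), \sum_i (if P i then F i * 0 else 0) = 0) *
   (forall P : pred 'I_N, \sum_i (if P i then 0 : E else 0) = 0) *
   (\sum_(i < N) (0 : E) = 0))%type.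
Proof.
by do !split=> *; apply: big1 => i _; rewrite ?mul0r ?mulr0 ?if_same.
Qed.

(** The rows below the new first row are all the old ones, so their sum is
    evaluated by the unitarity of the columns. *)
Lemma crossrel_cons N (U V : grid) :
  colunit N U V -> crossrel N U V -> crossrel N.+1 (grid_cons U) (grid_cons V).
Proof.
move=> hu hX [|i] [|j] [|k] [|b] iN jN kN bN /=.
all: rewrite !(big_mkcond (fun l : 'I__ => (_ < _)%N)) !big_ord_recl /= ?eqSS.
all: rewrite ?(sum_if0, mulr0, mul0r, mulr1, mul1r, scaler0, scale0r, addr0, add0r) //.
by rewrite hu //; case: (k == b); rewrite ?scaler0 ?scale0r.
have := hX i j k b iN jN kN bN.
by rewrite !(big_mkcond (fun l : 'I__ => (_ < _)%N)).
Qed.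

(** The identity matrix with the block (x, k; - q k, y) at rows and columns p and
    p + 1.  Exchanging x and y gives the matrix of the adjoint entries. *)
Definition givens (x k y : E) : nat -> grid := fix givens p := match p with
  | 0%N => fun i j => match i, j with
    | 0%N, 0%N => x | 0%N, 1%N => k | 1%N, 0%N => - (q *: k) | 1%N, 1%N => y
    | i'.+2, j'.+2 => (i' == j')%:R | _, _ => 0 end
  | p'.+1 => grid_cons (givens p') end.

(** For creation x, annihilation y and k = q ^ N with N the number operator,
    these are the relations of the coordinate algebra of quantum SU(2). *)
Definition oscillator (x k y : E) := [/\ y * x = 1 - q ^+ 2 *: (k * k),
  x * y = 1 - k * k, k * x = q *: (x * k) & y * k = q *: (k * y)].

Hypothesis q0 : q != 0.

Definition grid_id : grid := fun i j => (i == j)%:R.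

Lemma RTT_id : RTT grid_id.
Proof.
move=> i j i' j'; rewrite /grid_id -!natrM !mulnb [(j == j') && _]andbC.
have [/andP[/eqP-> /eqP->]|_] := boolP ((i == i') && _).
  have [->|ne] := eqVneq i' j'; first by rewrite !ltnn.
  by rewrite !scaler0.
rewrite !scaler0 !add0r; have [/andP[/eqP-> /eqP->]|_] := boolP (_ && _) => //.
by rewrite !scaler0.
Qed.

Lemma RTT_givens x k y p : oscillator x k y -> RTT (givens x k y p).
Proof.
case=> yx xy kx yk; elim: p => [|p IHp]; last exact: RTT_cons.
have dd (a b : nat) (z : E) : (a == b)%:R * z = z * (a == b)%:R.
  exact/esym/commr_nat.
move=> [|[|i]] [|[|j]] [|[|i']] [|[|j']]; rewrite /= ?eqSS ?ltnS.
all: rewrite ?(mulr0, mul0r, mulr1, mul1r, scaler0, scale0r, addr0, add0r) //.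
all: rewrite ?scale1r; try solve [exact: dd | exact/esym/dd].
all: rewrite ?(=^~ scalerAl, =^~ scalerAr, mulNr, mulrN).
all: rewrite ?(kx, yk, xy, yx).
all: try solve [by lin2 (x * k) (0 : E) | by lin2 (k * y) (0 : E) | by lin2 (1 : E) (k * k)].
exact: RTT_id.
Qed.

Lemma sum_delta N (P : pred nat) (a b : nat) : (a < N)%N ->
  \sum_(i < N | P i) (i == a :> nat)%:R * (i == b :> nat)%:R =
    (P a && (a == b))%:R :> E.
Proof.
move=> aN; rewrite big_mkcond (bigD1 (Ordinal aN)) //= big1 ?addr0 => [|i].
  by case: (P a); rewrite // eqxx mul1r.
by rewrite -val_eqE => /negPf /= ->; rewrite mul0r if_same.
Qed.

Lemma crossrel_id N : crossrel N grid_id grid_id.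
Proof.
move=> i j a b iN jN aN bN; rewrite /grid_id (sum_delta (fun l => i < l)%N) //.
under [in RHS]eq_bigr do rewrite [j == _]eq_sym [i == _]eq_sym.
rewrite (sum_delta (fun l => l < b)%N) // -!natrM !mulnb [(j == b) && _]andbC.
have [<-|ij] := eqVneq i j; have [<-|ab] := eqVneq a b => //=;
  rewrite ?andbT ?andbF ?scaler0 ?addr0.
- suff -> : (i == a) && (i == b) = false by rewrite !scaler0 scale0r addr0.
  by apply/negP => /andP[/eqP ia /eqP ib]; rewrite -ia -ib eqxx in ab.
- suff -> : (i == a) && (j == a) = false by rewrite !scaler0 scale0r addr0.
  by apply/negP => /andP[/eqP ia /eqP ja]; rewrite ia ja eqxx in ij.
by [].
Qed.

Lemma colunit_givens x k y p N : oscillator x k y -> (p.+1 < N)%N ->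
  colunit N (givens x k y p) (givens y k x p).
Proof.
case=> yx xy kx yk; elim: p N => [|p IHp] [|N] //= pN; last exact/colunit_cons/IHp.
case: N pN => // N _ [|[|a]] [|[|b]] aN bN; rewrite !big_ord_recl /=.
all: rewrite ?(sum_if0, mulr0, mul0r, addr0, add0r) //.
all: rewrite ?(mulNr, mulrN) -?(scalerAl, scalerAr) ?(yx, xy, kx, yk) ?addrN //.
- by lin2 (1 : E) (k * k).
- by rewrite addrC subrK.
- by rewrite eqSS (sum_delta predT).
Qed.

Lemma crossrel_givens x k y p N : oscillator x k y -> (p.+1 < N)%N ->
  crossrel N (givens x k y p) (givens y k x p).
Proof.
move=> osc; elim: p N => [|p IHp] [|N] //= pN; last first.
  by apply: crossrel_cons; [exact: colunit_givens|exact: IHp].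
case: osc => yx xy kx yk; case: N pN => // N _.
have dd (a b : nat) (z : E) : (a == b)%:R * z = z * (a == b)%:R.
  exact/esym/commr_nat.
move=> [|[|i]] [|[|j]] [|[|a]] [|[|b]] iN jN aN bN /=.
all: rewrite !(big_mkcond (fun l : 'I__ => (_ < _)%N)) !big_ord_recl /= ?eqSS.
all: rewrite ?(sum_if0, mulr0, mul0r, mulr1, mul1r, scaler0, scale0r, scale1r, addr0, add0r) //.
all: rewrite ?(=^~ scalerAl, =^~ scalerAr, mulNr, mulrN); try solve [exact: dd | exact/esym/dd].
all: rewrite ?(kx, yk, xy, yx).
all: try solve [by lin2 (x * k) (0 : E) | by lin2 (k * y) (0 : E) | by lin2 (1 : E) (k * k)].
- by rewrite subrK (sum_delta predT) //; case: (a == b); rewrite ?scale0r ?scaler0.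
- by rewrite addNr scaler0.
- by rewrite addNr scaler0.
- rewrite scalerN opprK scalerA -expr2 addrCA addrN addr0 (sum_delta predT) //.
  by case: (a == b); rewrite ?scale0r ?scaler0.
have := @crossrel_id N i j a b iN jN aN bN.
by rewrite !(big_mkcond (fun l : 'I__ => (_ < _)%N)).
Qed.

Lemma gridmul_givens x k y p N (X : grid) i c : (p.+1 < N)%N -> (c < N)%N ->
  gridmul N X (givens x k y p) i c =
  if c == p then X i p * x - q *: (X i p.+1 * k)
  else if c == p.+1 then X i p * k + X i p.+1 * y else X i c.
Proof.
rewrite /gridmul; move: (X i) => {}X; elim: p N c X => [|p IHp] [|N] c X // pN cN;
  last first.
  rewrite big_ord_recl /=; case: c cN => [|c] cN.
    by rewrite big1 ?addr0 ?mulr1 // => a _; rewrite mulr0.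
  by rewrite mulr0 add0r (IHp N c (fun a => X a.+1)).
case: N pN cN => // N _ cN; rewrite !big_ord_recl /=.
case: c cN => [|[|c]] cN /=; rewrite ?(sum_if0, addr0) //.
  by rewrite mulrN -scalerAr.
rewrite !mulr0 !add0r (bigD1 (Ordinal (cN : c < N)%N)) //= eqxx mulr1.
rewrite big1 ?addr0 // => a; rewrite -val_eqE => /negPf /= ac.
by rewrite -[(0 + a)%N]/(val a) ac mulr0.
Qed.

Lemma givens_ind (P : E -> Prop) x k y p : P 0 -> P 1 -> P x -> P k ->
  P (- (q *: k)) -> P y -> forall i j, P (givens x k y p i j).
Proof.
move=> P0 P1 Px Pk Pqk Py; elim: p => [|p IHp] [|[|i]] [|[|j]] //=.
by case: (i == j).
Qed.

End QuantumMatrixRelations.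

(** * Networks of Givens rotations *)

Section Network.
Context {K : fieldType} {E : algType K} {I : eqType}.
Variables (q : K) (N : nat).
Hypothesis q0 : q != 0.
Local Notation grid := (nat -> nat -> E).

(** The head of the list is the last factor of the product, so that a network is
    extended on the side of its outputs. *)
Fixpoint network (x k y : I -> E) (s : seq (nat * I)) : grid := match s with
  | [::] => grid_id
  | (p, b) :: s' => gridmul N (network x k y s') (givens q (x b) (k b) (y b) p) end.

Lemma network_ind (P : E -> Prop) x k y s : P 0 -> P 1 ->
    (forall u v, P u -> P v -> P (u + v)) -> (forall u v, P u -> P v -> P (u * v)) ->
    (forall b, b \in map snd s ->
      [/\ P (x b), P (k b), P (- (q *: k b)) & P (y b)]) ->
  forall i j, P (network x k y s i j).
Proof.
move=> P0 P1 PD PM; elim: s => [|[p b] s IHs] /= Ps i j.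
  by rewrite /grid_id; case: eqP.
apply: (big_ind P) => // a _; apply: PM.
  by apply: IHs => b' sb'; apply: Ps; rewrite inE sb' orbT.
have [Px Pk Pqk Py] := Ps b (mem_head _ _).
exact: givens_ind.
Qed.

Variables (x k y : I -> E).
Hypothesis oscI : forall b, oscillator q (x b) (k b) (y b).
Hypothesis commI : forall b b' u v, b != b' ->
  u \in [:: x b; k b; y b] -> v \in [:: x b'; k b'; y b'] -> GRing.comm u v.

Local Notation U := (network x k y).
Local Notation V := (network y k x).

Lemma network_comm s b z : b \notin map snd s -> z \in [:: x b; k b; y b] ->
  (forall i j, GRing.comm (U s i j) z) /\ (forall i j, GRing.comm (V s i j) z).
Proof.
move=> sb zb.
have cb b' : b' \in map snd s -> [/\ GRing.comm (x b') z, GRing.comm (k b') z,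
    GRing.comm (- (q *: k b')) z & GRing.comm (y b') z].
  move=> sb'; have ne : b' != b by apply: contraNneq sb => <-.
  have ck : GRing.comm (k b') z by apply: (commI ne); rewrite // !inE eqxx orbT.
  split=> //; try by apply: (commI ne); rewrite // !inE eqxx ?orbT.
  by apply/commr_sym/commrN; rewrite /GRing.comm -scalerAl -scalerAr ck.
have c0 : GRing.comm 0 z by apply/commr_sym/commr0.
have c1 : GRing.comm 1 z by apply/commr_sym/commr1.
have cD u v : GRing.comm u z -> GRing.comm v z -> GRing.comm (u + v) z.
  by move=> /commr_sym cu /commr_sym cv; apply/commr_sym/commrD.
have cM u v : GRing.comm u z -> GRing.comm v z -> GRing.comm (u * v) z.
  by move=> /commr_sym cu /commr_sym cv; apply/commr_sym/commrM.
by split=> i j; apply: (network_ind c0 c1 cD cM) => b' /cb[].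
Qed.

Lemma network_givens_comm s b p : b \notin map snd s ->
  [/\ grid_comm (U s) (givens q (x b) (k b) (y b) p),
      grid_comm (U s) (givens q (y b) (k b) (x b) p),
      grid_comm (V s) (givens q (x b) (k b) (y b) p) &
      grid_comm (V s) (givens q (y b) (k b) (x b) p)].
Proof.
move=> sb.
have c w z : (forall z, z \in [:: x b; k b; y b] -> GRing.comm w z) ->
   z \in [:: x b; k b; y b; 0; 1; - (q *: k b)] -> GRing.comm w z.
  move=> cw; rewrite !inE => /or4P[/eqP->|/eqP->|/eqP->|];
    try by apply: cw; rewrite !inE eqxx ?orbT.
  move=> /or3P[/eqP->|/eqP->|/eqP->]; [exact: commr0|exact: commr1|].
  apply: commrN; rewrite /GRing.comm -scalerAl -scalerAr cw //.
  by rewrite !inE eqxx orbT.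
by split=> i j i' j'; apply: givens_ind; apply: c => [z /(network_comm sb)[]|];
  rewrite ?inE ?eqxx ?orbT.
Qed.

(** Distinct boxes commute, so the stability of the three relations under
    products applies at each step. *)
Lemma network_rel s : uniq (map snd s) -> all (fun pb => pb.1.+1 < N)%N s ->
  [/\ RTT q (U s), crossrel q N (U s) (V s) & colunit N (U s) (V s)].
Proof.
elim: s => [_ _|[p b] s IHs] /=.
  by split; [exact: RTT_id|exact: crossrel_id|move=> c d cN _; exact: (sum_delta predT)].
case/andP=> sb us /andP[pN sN]; have [hR hX hU] := IHs us sN.
have [c1 c2 c3 _] := network_givens_comm p sb.
split; [apply: RTT_mul|apply: crossrel_mul|apply: colunit_mul] => //.
- exact: RTT_givens.
- exact: crossrel_givens.
- exact: colunit_givens.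
Qed.

Lemma network_adjoint (adj : E -> E -> Prop) s : uniq (map snd s) ->
    adj 0 0 -> adj 1 1 ->
    (forall u u' v v', adj u u' -> adj v v' -> adj (u + v) (u' + v')) ->
    (forall u u' v v', adj u u' -> adj v v' -> adj (u * v) (v' * u')) ->
    (forall b, [/\ adj (x b) (y b), adj (y b) (x b), adj (k b) (k b) &
       adj (- (q *: k b)) (- (q *: k b))]) ->
  forall i j, adj (U s i j) (V s i j).
Proof.
move=> us adj0 adj1 adjD adjM adjI.
have adj_givens b p i j :
    adj (givens q (x b) (k b) (y b) p i j) (givens q (y b) (k b) (x b) p i j).
  have [axy ayx ak aqk] := adjI b.
  elim: p i j => [|p IHp] [|[|i]] [|[|j]] //=; by case: (i == j).
elim: s us => [_|[p b] s IHs /= /andP[sb us]] i j.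
  by rewrite /= /grid_id; case: eqP.
have [_ _ _ cVG] := network_givens_comm p sb.
rewrite /gridmul; apply: (big_ind2 adj) => // a _; rewrite cVG.
exact/adjM/adj_givens/IHs.
Qed.

End Network.

(** * The Wick relation *)

Section Wick.
Context {K : fieldType} {E : algType K}.
Variables (q c : K) (N : nat).
Hypotheses (q0 : q != 0) (c0 : c != 0) (cq : c ^+ 2 = 1 - q ^+ 2).
Local Notation mu := (q - q^-1).

(** The operator by which the coefficients of the 1-forms, or the annihilators, are
    moved across a generator, for one of the two indices.  It inverts the
    operator given by [Rmx], see [rswap_Rmx]. *)
Definition rswap (W : lmodType K) (phi : nat -> nat -> W) (i j : nat) : W :=
  qdiag q (i == j) *: phi i j + qoff q (i == j) *: \sum_(l < j) phi l l.

Lemma rswapZ (W : lmodType K) a (phi : nat -> nat -> W) i j :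
  rswap (fun i' j' => a *: phi i' j') i j = a *: rswap phi i j.
Proof. by rewrite /rswap scalerDr -scaler_sumr !scalerA ![a * _]mulrC. Qed.

Lemma rswap_diag (W : lmodType K) (phi : nat -> nat -> W) i :
  rswap phi i i = q *: phi i i + mu *: \sum_(l < i) phi l l.
Proof. by rewrite /rswap eqxx. Qed.

Lemma rswap_off (W : lmodType K) (phi : nat -> nat -> W) i j :
  i != j -> rswap phi i j = phi i j.
Proof. by rewrite /rswap => /negPf->; rewrite scale1r scale0r addr0. Qed.

Variables (U V : nat -> nat -> E).
Hypotheses (UVx : crossrel q N U V) (UVu : colunit N U V).

(** The powers of q compensate the asymmetry of [crossrel] between rows, and c
    normalises the constant term of the Wick relation to 1. *)
Definition creat (j b : nat) : E := (c^-1 * q ^- j) *: U j b.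
Definition annih (i k : nat) : E := (c^-1 * q ^- i) *: V i k.

Let psi k b i : E := V i k * U i b.
Let phi k b i : E := rswap (fun k' b' => U i b' * V i k') k b.

Lemma crossrel_rswap i j k b : (i < N)%N -> (j < N)%N -> (k < N)%N -> (b < N)%N ->
  qdiag q (i == j) *: (V i k * U j b) +
    qoff q (i == j) *: \sum_(l < N | (i < l)%N) V l k * U l b =
  rswap (fun k' b' => U j b' * V i k') k b.
Proof.
move=> iN jN kN bN; rewrite UVx // /rswap; congr (_ + _ *: _).
by rewrite (big_ord_widen N (fun a => U j a * V i a)) // ltnW.
Qed.

(** For equal row indices [crossrel] at row i expresses V U in that row by U V and
    the sum of V U over the lower rows.  Subtracting consecutive rows removes the
    lower sums, and the first row is evaluated by unitarity, so V U is obtained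
    from the rows above by induction. *)
Lemma wick_diag i k b : (i < N)%N -> (k < N)%N -> (b < N)%N ->
  (q ^- i * q ^- i) *: psi k b i =
  q *: ((q ^- i * q ^- i) *: phi k b i) +
    mu *: \sum_(l < i) (q ^- l * q ^- l) *: phi k b l + (c ^+ 2 * (k == b)%:R)%:A.
Proof.
move=> iN kN bN.
pose tau i := \sum_(l < N | (i < l)%N) psi k b l.
have E1 i' : (i' < N)%N -> q *: psi k b i' + mu *: tau i' = phi k b i'.
  by move=> i'N; rewrite /phi -crossrel_rswap // eqxx.
have tauS i' : (i'.+1 < N)%N -> tau i' = psi k b i'.+1 + tau i'.+1.
  move=> i'N; rewrite /tau (bigD1 (Ordinal i'N)) //=; congr (_ + _).
  by apply: eq_bigl => l; rewrite -val_eqE /= [in RHS]ltn_neqAle eq_sym andbC.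
have tau0 : (0 < N)%N -> psi k b 0 + tau 0%N = (k == b)%:R.
  move=> N0; rewrite -(UVu kN bN) [RHS](bigD1 (Ordinal N0)) //=; congr (_ + _).
  by apply: eq_bigl => l; rewrite -val_eqE /= lt0n.
elim: i iN => [|i IHi] iN.
  rewrite big_ord0 scaler0 addr0 !expr0 invr1 mulr1 !scale1r -E1 // cq.
  have -> : tau 0%N = (k == b)%:R - psi k b 0 by rewrite -tau0 // addrC addKr.
  rewrite (_ : ((1 - q ^+ 2) * _)%:A = (1 - q ^+ 2) *: (k == b)%:R :> E); last first.
    by rewrite -scalerA; congr (_ *: _); rewrite scaler_nat.
  by lin2 (psi k b 0) ((k == b)%:R : E).
(* The difference of the relations E1 at i and at i + 1. *)
have E2 : psi k b i.+1 = q *: (phi k b i.+1 - phi k b i + q *: psi k b i).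
  rewrite -!E1 ?(ltnW iN) // (tauS i) //.
  by lin4 (psi k b i) (psi k b i.+1) (tau i.+1) (0 : E).
rewrite big_ord_recr /= [mu *: (_ + _)]scalerDr.
have := IHi (ltnW iN); rewrite -addrA => /esym/(canRL (addKr _)) IH.
rewrite -[RHS]addrA [in RHS]addrAC IH E2 exprSr invfM.
by set w := q ^- i; lin4 (psi k b i) (phi k b i) (phi k b i.+1) (0 : E).
Qed.

(** Moving an annihilator across a creator swaps the row indices and the column
    indices by independent copies of [rswap]; the only inhomogeneous term comes
    from matching indices.  The q-derivatives satisfy the same rule with respect
    to right multiplications. *)
Lemma wick i j k b : (i < N)%N -> (j < N)%N -> (k < N)%N -> (b < N)%N ->
  annih i k * creat j b =
  rswap (fun i' j' => rswap (fun k' b' => creat j' b' * annih i' k') k b) i j +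
  ((i == j) && (k == b))%:R.
Proof.
move=> iN jN kN bN; rewrite /annih /creat -scalerAl -scalerAr scalerA.
have CA i' j' :
    rswap (fun k' b' => (c^-1 * q ^- j') *: U j' b' * ((c^-1 * q ^- i') *: V i' k')) k b =
    (c ^- 2 * (q ^- i' * q ^- j')) *: rswap (fun k' b' => U j' b' * V i' k') k b.
  rewrite -rswapZ; congr rswap; apply/funext => k'; apply/funext => b'.
  rewrite -scalerAl -scalerAr scalerA; congr (_ *: _); rewrite expr2 invfM; ring.
have [<-|ij] := eqVneq i j; last first.
  rewrite addr0 rswap_off // CA -crossrel_rswap // (negPf ij).
  rewrite scale0r addr0 scale1r; congr (_ *: _); rewrite expr2 invfM; ring.
rewrite /= (_ : c^-1 * q ^- i * (c^-1 * q ^- i) = c ^- 2 * (q ^- i * q ^- i));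
  last by rewrite expr2 invfM; ring.
rewrite -scalerA wick_diag // rswap_diag CA; under [in RHS] eq_bigr do rewrite CA.
under [in RHS]eq_bigr do rewrite -scalerA.
rewrite -scaler_sumr ![c ^- 2 *: (_ + _)]scalerDr [_ *: _%:A]scalerA mulKf ?expf_neq0 //.
rewrite scaler_nat; congr (_ + _ + _); rewrite ?[LHS]scalerA ?[RHS]scalerA.
  by congr (_ *: _); ring.
by rewrite [_ * mu]mulrC.
Qed.

End Wick.

(** * Oscillators on the Fock space *)

Section Endomorphisms.
Context {K : fieldType} {I : eqType}.

(** All the functions of the occupation numbers are admitted: the operators in use
    only look at finitely many values at a time, and finite support matters only
    for the inner product [dotF]. *)
Definition fock : Type := (I -> nat) -> K^o.
HB.instance Definition _ := GRing.Lmodule.on fock.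

Record endo := Endo { endo_fun :> fock -> fock; endo_linear : linear endo_fun }.

HB.instance Definition _ := gen_eqMixin endo.
HB.instance Definition _ := gen_choiceMixin endo.

Lemma endoP (u v : endo) : (forall f, u f = v f) -> u = v.
Proof.
case: u v => [u lu] [v lv] /= /funext uv; subst v.
by rewrite (Prop_irrelevance lu lv).
Qed.

Lemma endoD (u : endo) f g : u (f + g) = u f + u g.
Proof. by have := endo_linear u 1 f g; rewrite !scale1r. Qed.

Lemma endo0 (u : endo) : u 0 = 0.
Proof. by apply: (addrI (u 0)); rewrite -endoD !addr0. Qed.

Lemma endoZ (u : endo) (c : K) f : u (c *: f) = c *: u f.
Proof. by have := endo_linear u c f 0; rewrite endo0 !addr0. Qed.

Lemma endo_zero_subproof : linear (fun _ : fock => 0 : fock).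
Proof. by move=> c f g; rewrite scaler0 addr0. Qed.
Lemma endo_opp_subproof (u : endo) : linear (fun f => - u f).
Proof. by move=> c f g; rewrite endoD endoZ opprD scalerN. Qed.
Lemma endo_add_subproof (u v : endo) : linear (fun f => u f + v f).
Proof. by move=> c f g; rewrite !endoD !endoZ scalerDr addrACA. Qed.
Lemma endo_scale_subproof c (u : endo) : linear (fun f => c *: u f).
Proof. by move=> e f g; rewrite endoD endoZ scalerDr !scalerA mulrC. Qed.
Lemma endo_mul_subproof (u v : endo) : linear (fun f => u (v f)).
Proof. by move=> e f g; rewrite !endoD !endoZ. Qed.
Lemma endo_one_subproof : linear (fun f : fock => f). Proof. by []. Qed.

Definition endo_zero := Endo endo_zero_subproof.
Definition endo_opp u := Endo (endo_opp_subproof u).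
Definition endo_add u v := Endo (endo_add_subproof u v).
Definition endo_scale c u := Endo (endo_scale_subproof c u).
Definition endo_mul u v := Endo (endo_mul_subproof u v).
Definition endo_one := Endo endo_one_subproof.

Lemma endo_addA : associative endo_add.
Proof. by move=> u v w; apply: endoP => f /=; rewrite addrA. Qed.
Lemma endo_addC : commutative endo_add.
Proof. by move=> u v; apply: endoP => f /=; rewrite addrC. Qed.
Lemma endo_add0 : left_id endo_zero endo_add.
Proof. by move=> u; apply: endoP => f /=; rewrite add0r. Qed.
Lemma endo_addN : left_inverse endo_zero endo_opp endo_add.
Proof. by move=> u; apply: endoP => f /=; rewrite addNr. Qed.
HB.instance Definition _ :=
  GRing.isZmodule.Build endo endo_addA endo_addC endo_add0 endo_addN.

Lemma endo_mulA : associative endo_mul. Proof. by move=> u v w; apply: endoP. Qed.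
Lemma endo_mul1l : left_id endo_one endo_mul. Proof. by move=> u; apply: endoP. Qed.
Lemma endo_mul1r : right_id endo_one endo_mul. Proof. by move=> u; apply: endoP. Qed.
Lemma endo_mulDl : left_distributive endo_mul endo_add.
Proof. by move=> u v w; apply: endoP. Qed.
Lemma endo_mulDr : right_distributive endo_mul endo_add.
Proof. by move=> u v w; apply: endoP => f /=; rewrite endoD. Qed.
Lemma endo_1neq0 : endo_one != 0 :> endo.
Proof.
apply/eqP => /(congr1 (fun u : endo => u (fun=> 1) (fun=> 0%N))) /= /eqP.
by rewrite oner_eq0.
Qed.
HB.instance Definition _ := GRing.Zmodule_isNzRing.Build endo
  endo_mulA endo_mul1l endo_mul1r endo_mulDl endo_mulDr endo_1neq0.

Lemma endo_scaleA c e u : endo_scale c (endo_scale e u) = endo_scale (c * e) u.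
Proof. by apply: endoP => f /=; rewrite scalerA. Qed.
Lemma endo_scale1 : left_id 1 endo_scale.
Proof. by move=> u; apply: endoP => f /=; rewrite scale1r. Qed.
Lemma endo_scaleDr : right_distributive endo_scale +%R.
Proof. by move=> c u v; apply: endoP => f /=; rewrite scalerDr. Qed.
Lemma endo_scaleDl u : {morph endo_scale^~ u : c e / c + e}.
Proof. by move=> c e; apply: endoP => f /=; rewrite scalerDl. Qed.
HB.instance Definition _ := GRing.Zmodule_isLmodule.Build K endo
  endo_scaleA endo_scale1 endo_scaleDr endo_scaleDl.

Lemma endo_scaleAl (c : K) (u v : endo) : c *: (u * v) = (c *: u) * v.
Proof. exact: endoP. Qed.
HB.instance Definition _ := GRing.Lmodule_isLalgebra.Build K endo endo_scaleAl.
Lemma endo_scaleAr (c : K) (u v : endo) : c *: (u * v) = u * (c *: v).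
Proof. by apply: endoP => f /=; rewrite endoZ. Qed.
HB.instance Definition _ := GRing.Lalgebra_isAlgebra.Build K endo endo_scaleAr.

Lemma endo_sumE J (r : seq J) (P : pred J) (F : J -> endo) f :
  (\sum_(j <- r | P j) F j) f = \sum_(j <- r | P j) F j f.
Proof. by elim/big_rec2: _ => // j u v _ <-. Qed.

Lemma weighted_subst_subproof (w : (I -> nat) -> K) (s : (I -> nat) -> I -> nat) :
  linear (fun f : fock => (fun v => w v * f (s v)) : fock).
Proof. by move=> c f g; apply/funext => v /=; rewrite mulrDr mulrCA. Qed.

(** The class of operators which contains the creations, the annihilations and the
    powers of q; it is closed under products, with explicit composites. *)
Definition weighted_subst w s : endo := Endo (weighted_subst_subproof w s).

Lemma weighted_substM w s w' s' : weighted_subst w s * weighted_subst w' s' =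
  weighted_subst (fun v => w v * w' (s v)) (s' \o s).
Proof. by apply: endoP => f; apply/funext => v /=; rewrite mulrA. Qed.

Lemma weighted_subst_comm w s w' s' : (forall v, s (s' v) = s' (s v)) ->
    (forall v, w (s' v) = w v) -> (forall v, w' (s v) = w' v) ->
  GRing.comm (weighted_subst w s) (weighted_subst w' s').
Proof.
move=> ss' ws' w's; rewrite /GRing.comm !weighted_substM; apply: endoP => f.
by apply/funext => v /=; rewrite ss' ws' w's [w v * _]mulrC.
Qed.

End Endomorphisms.
Arguments fock : clear implicits.
Arguments endo : clear implicits.

Section Oscillators.
Local Open Scope classical_set_scope.
Context {K : numClosedFieldType} {I : eqType}.
Variable q : K.
Hypothesis hq : 0 < q < 1.
Implicit Types (v : I -> nat) (b : I).

Definition set_occ b c v : I -> nat := fun b' => if b' == b then c else v b'.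

Lemma set_occE b c v : set_occ b c v b = c. Proof. by rewrite /set_occ eqxx. Qed.
Lemma set_occ_ne b b' c v : b' != b -> set_occ b c v b' = v b'.
Proof. by rewrite /set_occ => /negPf->. Qed.
Lemma set_occ2 b c c' v : set_occ b c (set_occ b c' v) = set_occ b c v.
Proof. by apply/funext => b'; rewrite /set_occ; case: eqP. Qed.
Lemma set_occ_id b v : set_occ b (v b) v = v.
Proof. by apply/funext => b'; rewrite /set_occ; case: eqP => // ->. Qed.
Lemma set_occC b b' c c' v : b != b' ->
  set_occ b c (set_occ b' c' v) = set_occ b' c' (set_occ b c v).
Proof.
move=> /negPf bb'; apply/funext => d; rewrite /set_occ.
by case: eqP => // ->; rewrite bb'.
Qed.

(** The matrix entry of creation between the levels k - 1 and k.  As it vanishes for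
    k = 0, creation may read the value at the truncated predecessor. *)
Definition osc_weight (k : nat) : K := sqrtC (1 - (q ^+ k) ^+ 2).

Definition osc_up b : endo K I :=
  weighted_subst (fun v => osc_weight (v b)) (fun v => set_occ b (v b).-1 v).
Definition osc_down b : endo K I :=
  weighted_subst (fun v => osc_weight (v b).+1) (fun v => set_occ b (v b).+1 v).
Definition osc_diag b : endo K I := weighted_subst (fun v => q ^+ v b) id.

Lemma osc_weight0 : osc_weight 0 = 0.
Proof. by rewrite /osc_weight expr0 expr1n subrr sqrtC0. Qed.

Lemma osc_weight_sqr k : osc_weight k * osc_weight k = 1 - q ^+ k * q ^+ k.
Proof. by rewrite -expr2 sqrtCK expr2. Qed.

Lemma osc_oscillator b : oscillator q (osc_up b) (osc_diag b) (osc_down b).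
Proof.
have E : forall u u' : endo K I, (forall f v, u f v = u' f v) -> u = u'.
  by move=> u u' uu'; apply: endoP => f; apply/funext => v; exact: uu'.
split; apply: E => f v /=.
- rewrite set_occ2 set_occE /= set_occ_id mulrA osc_weight_sqr.
  rewrite -[RHS]/(f v - q ^+ 2 * (q ^+ v b * (q ^+ v b * f v))).
  rewrite exprS; ring.
- rewrite -[RHS]/(f v - q ^+ v b * (q ^+ v b * f v)).
  rewrite set_occ2 set_occE; case vb: (v b) => [|k] /=.
    by rewrite osc_weight0 expr0 !mul1r mul0r subrr.
  by rewrite -vb set_occ_id vb mulrA osc_weight_sqr -vb; ring.
- rewrite -[RHS]/(q * (osc_weight (v b) * (q ^+ _ * f _))) set_occE.
  case vb: (v b) => [|k] /=; first by rewrite osc_weight0 !(mul0r, mulr0).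
  by rewrite exprS; ring.
- rewrite -[RHS]/(q * (q ^+ v b * (osc_weight (v b).+1 * f _))) set_occE exprS; ring.
Qed.

Lemma osc_comm b b' u w : b != b' ->
  u \in [:: osc_up b; osc_diag b; osc_down b] ->
  w \in [:: osc_up b'; osc_diag b'; osc_down b'] -> GRing.comm u w.
Proof.
move=> bb'; have b'b : b' != b by rewrite eq_sym.
by rewrite !inE => /or3P[] /eqP-> /or3P[] /eqP->; apply: weighted_subst_comm => v //=;
  rewrite ?(set_occ_ne _ _ bb') ?(set_occ_ne _ _ b'b) // set_occC.
Qed.

Definition supported (r : seq (I -> nat)) (f : fock K I) :=
  forall v, v \notin r -> f v = 0.
Definition finitary f := exists r, supported r f.

Definition dotF (f g : fock K I) : K :=
  \sum_(v \in [set: I -> nat]) (f v : K) * ((g v : K)^*).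

Lemma dotFE r f g : supported r g -> dotF f g = \sum_(v <- undup r) (f v : K) * (g v : K)^*.
Proof.
move=> rg; rewrite /dotF (fsbigE (undup r)) ?undup_uniq //; last first.
  by move=> v _; rewrite mem_undup => /rg->; rewrite rmorph0 mulr0.
by apply: eq_bigl => v; rewrite in_setT.
Qed.

Lemma dotFC f g : finitary f -> finitary g -> dotF f g = (dotF g f)^*.
Proof.
move=> [r rf] [r' rg].
rewrite (@dotFE (r ++ r') f); last by move=> v; rewrite mem_cat negb_or => /andP[_ /rg].
rewrite (@dotFE (r ++ r') g); last by move=> v; rewrite mem_cat negb_or => /andP[/rf].
by rewrite rmorph_sum; apply: eq_bigr => v _; rewrite rmorphM /= conjCK mulrC.
Qed.

Lemma dotF_linear g c f f' : finitary g ->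
  dotF (c *: f + f') g = c * dotF f g + dotF f' g.
Proof.
move=> [r rg]; rewrite !(dotFE _ rg) mulr_sumr -big_split; apply: eq_bigr => v _.
by rewrite -[LHS]/((c * f v + f' v : K) * (g v : K)^*) mulrDl mulrA.
Qed.

Lemma dotF_gt0 f : finitary f -> f != 0 -> 0 < dotF f f.
Proof.
move=> [r rf] f0; rewrite (dotFE _ rf) lt_def sumr_ge0 ?andbT => [|v _]; last first.
  by rewrite mul_conjC_ge0.
apply: contra f0; rewrite psumr_eq0 => [/allP f0|v _]; last by rewrite mul_conjC_ge0.
apply/eqP/funext => v; have [vr|/rf//] := boolP (v \in r).
by have /f0 : v \in undup r by [rewrite mem_undup]; rewrite /= mul_conjC_eq0 => /eqP.
Qed.

Lemma osc_up_finitary b f : finitary f -> finitary (osc_up b f).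
Proof.
move=> [r rf]; exists [seq set_occ b (v b).+1 v | v <- r] => v vr /=.
case vb: (v b) => [|k]; first by rewrite osc_weight0 mul0r.
rewrite rf ?mulr0 //; apply: contra vr => vr; apply/mapP; exists (set_occ b k v) => //.
by rewrite set_occ2 set_occE -vb set_occ_id.
Qed.

Lemma osc_down_finitary b f : finitary f -> finitary (osc_down b f).
Proof.
move=> [r rf]; exists [seq set_occ b (v b).-1 v | v <- r] => v vr /=.
rewrite rf ?mulr0 //; apply: contra vr => vr; apply/mapP.
by exists (set_occ b (v b).+1 v) => //; rewrite set_occ2 set_occE set_occ_id.
Qed.

Lemma osc_diag_finitary b f : finitary f -> finitary (osc_diag b f).
Proof. by move=> [r rf]; exists r => v /rf /= ->; rewrite mulr0. Qed.

Lemma osc_weight_conj k : (osc_weight k)^* = osc_weight k.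
Proof.
apply/CrealP/ger0_real; rewrite sqrtC_ge0 subr_ge0 -exprM exprn_ile1 //.
  by case/andP: hq => /ltW.
by case/andP: hq => _ /ltW.
Qed.

Lemma q_conj k : (q ^+ k)^* = q ^+ k.
Proof. by apply/CrealP/ger0_real/exprn_ge0; case/andP: hq => /ltW. Qed.

(** The substitution that raises one occupation number is a bijection onto the
    states where this number is positive, and the other states have
    weight 0. *)
Lemma osc_up_adjoint b f g : dotF (osc_up b f) g = dotF f (osc_down b g).
Proof.
rewrite /dotF -(@fsbig_widen _ _ _ _ [set v | (0 < v b)%N]) //; last first.
  move=> v [_ /negP]; rewrite /= -leqNgt leqn0 => /eqP vb.
  by rewrite vb osc_weight0 !mul0r.
rewrite (@reindex_fsbig _ _ _ _ _ (fun v => set_occ b (v b).+1 v) [set: I -> nat]).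
  apply: eq_fsbigr => v _ /=; rewrite set_occ2 set_occE /= set_occ_id.
  by rewrite rmorphM /= osc_weight_conj [RHS]mulrCA mulrA.
split => [v _ /=|v w _ _|v /= vb].
- by rewrite set_occE.
- move=> /(congr1 (fun u => set_occ b (u b).-1 u)).
  by rewrite !set_occ2 !set_occE /= !set_occ_id.
- exists (set_occ b (v b).-1 v) => //.
  by rewrite set_occ2 set_occE prednK // set_occ_id.
Qed.

Lemma osc_down_adjoint b f g : finitary f -> finitary g ->
  dotF (osc_down b f) g = dotF f (osc_up b g).
Proof.
move=> ff fg; rewrite dotFC //; last exact: osc_down_finitary.
by rewrite -osc_up_adjoint -dotFC //; exact: osc_up_finitary.
Qed.

Lemma osc_diag_adjoint b f g : dotF (osc_diag b f) g = dotF f (osc_diag b g).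
Proof.
by apply: eq_fsbigr => v _ /=; rewrite rmorphM /= q_conj [RHS]mulrCA mulrA.
Qed.

End Oscillators.

(** * The network that represents the generators *)

Section Schedule.
Variables (m n : nat).

(** The horizontal line i leaves position i and crosses vertical lines 0, ..., j - 1;
    it meets the vertical line j' when it is at position i + j', whence the place of
    that rotation. *)
Fixpoint row_boxes i j (s : seq (nat * (nat * nat))) := match j with
  | 0%N => s | j'.+1 => (i + j', (i, j'))%N :: row_boxes i j' s end.

(** The last horizontal line goes first: it is the only one next to the vertical
    lines.  After line i is done, the vertical lines occupy the positions
    i, ..., i + n - 1. *)
Fixpoint rows_boxes d := match d with
  | 0%N => [::] | d'.+1 => row_boxes (m - d) n (rows_boxes d') end.

Lemma mem_row_boxes i j s p b :
  ((p, b) \in row_boxes i j s) = ((p, b) \in s) || [&& b.1 == i, (b.2 < j)%N & p == (b.1 + b.2)%N].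
Proof.
elim: j => [|j IHj] /=; first by rewrite andbF orbF.
rewrite inE {}IHj; case: b => b1 b2 /=; rewrite !xpair_eqE orbCA; congr (_ || _).
rewrite ltnS [(b2 <= j)%N]leq_eqVlt; case: (b1 =P i) => [->|_] /=; last by rewrite andbF.
by case: (b2 =P j) => [->|_] /=; rewrite ?andbT ?andbF // ltnn /= orbF.
Qed.

Lemma mem_rows_boxes d p b : (d <= m)%N ->
  ((p, b) \in rows_boxes d) =
  [&& (m - d <= b.1)%N, (b.1 < m)%N, (b.2 < n)%N & p == (b.1 + b.2)%N].
Proof.
elim: d => [|d IHd] dm; first by rewrite subn0 in_nil; case: leqP => //= bm; rewrite ltnNge bm.
rewrite /= mem_row_boxes IHd ?(ltnW dm) //; case: (b.2 < n)%N; rewrite ?andbF //=.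
case: (p == _); rewrite ?andbF //= !andbT; lia.
Qed.

Lemma uniq_row_boxes i j s : (forall j', (i, j') \notin map snd s) ->
  uniq (map snd s) -> uniq (map snd (row_boxes i j s)).
Proof.
move=> si us; elim: j => [//|j IHj] /=; rewrite {}IHj andbT.
apply/negP => /mapP[[p b]]; rewrite mem_row_boxes => /= /orP[sb ib|].
  by move: (si j); rewrite ib (map_f snd sb).
by case/and3P=> _ + _ => /[swap] <- /=; rewrite ltnn.
Qed.

Lemma uniq_rows_boxes d : (d <= m)%N -> uniq (map snd (rows_boxes d)).
Proof.
elim: d => [//|d IHd] dm; apply: uniq_row_boxes; last exact/IHd/ltnW.
move=> j; apply/negP => /mapP[[p b]]; rewrite mem_rows_boxes ?(ltnW dm) // => /and4P[+ _ _ _] /= eb.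
rewrite -eb /=; lia.
Qed.

Lemma rows_boxes_lt : all (fun pb => pb.1.+1 < m + n)%N (rows_boxes m).
Proof.
apply/allP => -[p b]; rewrite mem_rows_boxes //= => /and4P[_ ? ? /eqP->]; lia.
Qed.

End Schedule.

Section FockModel.
Context {K : numClosedFieldType}.
Variables (q : K) (m n : nat).
Hypothesis hq : 0 < q < 1.
Local Notation I := (nat * nat)%type.
Local Notation N := (m + n)%N.
Local Notation W := (fock K I).

Definition vacuum : W := fun v => (v == (fun=> 0%N))%:R.

Lemma osc_down_vacuum b : osc_down q b vacuum = 0.
Proof.
apply/funext => v /=; rewrite /vacuum; case: eqP => [/(congr1 (@^~ b))|_].
  by rewrite set_occE.
by rewrite mulr0.
Qed.

Lemma osc_diag_vacuum b : osc_diag q b vacuum = vacuum.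
Proof.
apply/funext => v /=; rewrite /vacuum; case: eqP => [->|_]; last by rewrite mulr0.
by rewrite expr0 mul1r.
Qed.

Lemma vacuum_finitary : finitary vacuum.
Proof. by exists [:: (fun=> 0%N)] => v; rewrite inE /vacuum => /negPf->. Qed.

Lemma dotF_vacuum : dotF vacuum vacuum = 1.
Proof.
rewrite (@dotFE _ _ [:: (fun=> 0%N)]) /=; last first.
  by move=> v; rewrite inE /vacuum => /negPf->.
by rewrite big_seq1 /vacuum eqxx -[LHS]/(1 * 1^* : K) rmorph1 mulr1.
Qed.

Local Notation Unet := (network q N (osc_up q) (osc_diag q) (osc_down q)).
Local Notation Vnet := (network q N (osc_down q) (osc_diag q) (osc_up q)).

(** The positions of the vertical lines when the horizontal line i has crossed j of
    them. *)
Let column i j p := (i <= p <= i + n)%N && (p != i + j)%N.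

(** A path that starts on a horizontal line and is now on a vertical one has used
    one annihilation more than creations.  At the box (i, j) such a path either
    turns there, through the annihilation of a fresh oscillator, or was on that
    vertical line already, and passes through a power of q, which fixes the
    vacuum. *)
Lemma network_row_vacuum i j s : (i < m)%N -> (j <= n)%N ->
  (forall h p, (h < m)%N -> column i 0 p -> Vnet s h p vacuum = 0) ->
  forall h p, (h < m)%N -> column i j p -> Vnet (row_boxes i j s) h p vacuum = 0.
Proof.
move=> im + V0 h; elim: j => [|j IHj] jn p hm; first exact: V0.
rewrite /column => /andP[ip pj] /=; rewrite gridmul_givens; [|lia..].
have {}IHj := IHj (ltnW jn) _ hm.
case: eqP => [_|pj1].
  rewrite -[LHS]/(Vnet (row_boxes i j s) h (i + j)%N (osc_down q (i, j) vacuum) -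
    q *: Vnet (row_boxes i j s) h (i + j).+1 (osc_diag q (i, j) vacuum)).
  rewrite osc_down_vacuum endo0 osc_diag_vacuum IHj ?scaler0 ?subr0 //.
  by rewrite /column; lia.
case: eqP => [pe|_]; first by move: pj; rewrite pe addnS eqxx.
by apply: IHj; rewrite /column; lia.
Qed.

Lemma network_vacuum i k : (i < m)%N -> (k < n)%N -> Vnet (rows_boxes m n m) i k vacuum = 0.
Proof.
move=> im kn.
(* After d rows the vertical lines occupy the positions m - d, ..., m - d + n - 1. *)
suff H d : (d <= m)%N -> forall h p, (h < m)%N -> (m - d <= p < m - d + n)%N ->
    Vnet (rows_boxes m n d) h p vacuum = 0.
  by apply: H; rewrite // subnn.
elim: d => [_ h p hm /= /andP[mp _]|d IHd dm h p hm hp].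
  by rewrite /grid_id (_ : h == p = false) //; apply/eqP; lia.
apply: network_row_vacuum => //; try by rewrite /column; lia.
by move=> h' p' h'm; rewrite /column => hp'; apply: IHd => //; lia.
Qed.

(** Adjointness on the vectors of finite support, which both operators must
    preserve for the notion to be stable under composition. *)
Definition adjoint_pair (u u' : endo K I) := [/\ forall f, finitary f -> finitary (u f),
  forall f, finitary f -> finitary (u' f) &
  forall f g, finitary f -> finitary g -> dotF (u f) g = dotF f (u' g)].

Lemma finitaryD (f g : W) : finitary f -> finitary g -> finitary (f + g).
Proof.
move=> [r rf] [r' rg]; exists (r ++ r') => v; rewrite mem_cat negb_or => /andP[/rf fv /rg gv].
by rewrite -[LHS]/(f v + g v) fv gv addr0.
Qed.

Lemma finitaryZ c (f : W) : finitary f -> finitary (c *: f).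
Proof. by move=> [r rf]; exists r => v /rf fv; rewrite -[LHS]/(c * f v) fv mulr0. Qed.

Lemma finitary0 : finitary (0 : W). Proof. by exists [::]. Qed.

Lemma dotFD (f f' g : W) : finitary g -> dotF (f + f') g = dotF f g + dotF f' g :> K.
Proof. by move=> fg; have := @dotF_linear _ I g 1 f f' fg; rewrite scale1r mul1r. Qed.

Lemma dotF0 (g : W) : finitary g -> dotF (0 : W) g = 0.
Proof. by move=> fg; apply: (addrI (dotF 0 g)); rewrite -dotFD // !addr0. Qed.

Lemma dotFZ c (f g : W) : finitary g -> dotF (c *: f) g = c * dotF f g :> K.
Proof. by move=> fg; have := @dotF_linear _ I g c f 0 fg; rewrite dotF0 // !addr0. Qed.

Lemma dotFDr (f g g' : W) : finitary f -> finitary g -> finitary g' ->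
  dotF f (g + g') = dotF f g + dotF f g' :> K.
Proof.
by move=> ff fg fg'; rewrite (dotFC ff (finitaryD fg fg')) dotFD // rmorphD /= -!dotFC.
Qed.

Lemma dotFZr c (f g : W) : finitary f -> finitary g -> dotF f (c *: g) = c^* * dotF f g :> K.
Proof.
by move=> ff fg; rewrite (dotFC ff (finitaryZ c fg)) dotFZ // rmorphM /= -dotFC.
Qed.

Lemma adjointZ c u u' : c^* = c -> adjoint_pair u u' -> adjoint_pair (c *: u) (c *: u').
Proof.
move=> cc [fu fu' uu']; split=> [f ff|f ff|f g ff fg].
- exact/finitaryZ/fu.
- exact/finitaryZ/fu'.
- by rewrite dotFZ // uu' // dotFZr ?cc //; exact: fu'.
Qed.

Lemma network_adjoint_pair s i j : uniq (map snd s) -> adjoint_pair (Unet s i j) (Vnet s i j).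
Proof.
move=> us; apply: network_adjoint => //.
- exact: osc_comm.
- split=> [f _|f _|f g ff fg]; try exact: finitary0.
  by rewrite dotF0 // dotFC ?dotF0 ?rmorph0 //; exact: finitary0.
- move=> u u' v v' [fu fu' uu'] [fv fv' vv']; split=> [f ff|f ff|f g ff fg].
  + by apply: finitaryD; [apply: fu|apply: fv].
  + by apply: finitaryD; [apply: fu'|apply: fv'].
  + by rewrite dotFD // uu' // vv' // -dotFDr //; [apply: fu'|apply: fv'].
- move=> u u' v v' [fu fu' uu'] [fv fv' vv']; split=> [f ff|f ff|f g ff fg].
  + exact/fu/fv.
  + exact/fv'/fu'.
  + by rewrite uu' ?vv' //; [apply: fu'|apply: fv].
move=> b.
have ak : adjoint_pair (osc_diag q b) (osc_diag q b).
  by split=> [||f g _ _]; [exact: osc_diag_finitary..|exact: osc_diag_adjoint].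
split=> //.
- by split=> [||f g _ _]; [exact: osc_up_finitary|exact: osc_down_finitary|exact: osc_up_adjoint].
- by split; [exact: osc_down_finitary|exact: osc_up_finitary|exact: osc_down_adjoint].
rewrite -scaleNr; apply: adjointZ => //.
by rewrite rmorphN /=; have := q_conj hq 1; rewrite expr1 => ->.
Qed.

(** The rows 0, ..., m - 1 of the network belong to the horizontal inputs and the
    columns 0, ..., n - 1 to the vertical outputs. *)
Lemma fock_model : exists Z D : nat -> nat -> endo K I,
  [/\ RTT q Z,
      forall i j k b, (i < m)%N -> (j < m)%N -> (k < n)%N -> (b < n)%N ->
        D i k * Z j b = rswap q (fun i' j' => rswap q (fun k' b' => Z j' b' * D i' k') k b) i j +
          ((i == j) && (k == b))%:R,
      forall i k, (i < m)%N -> (k < n)%N -> D i k vacuum = 0 &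
      forall i k, adjoint_pair (Z i k) (D i k)].
Proof.
have q0 : q != 0 by case/andP: hq => /gt_eqF->.
pose c := osc_weight q 1.
have cq : c ^+ 2 = 1 - q ^+ 2 by rewrite expr2 osc_weight_sqr expr1 expr2.
have c0 : c != 0.
  by rewrite -sqrf_eq0 cq subr_eq0 eq_sym lt_eqF // exprn_ilt1 //; case/andP: hq => /ltW.
have [hR hX hU] := network_rel q0 (@osc_oscillator _ _ q) (@osc_comm _ _ q)
  (uniq_rows_boxes n (leqnn m)) (rows_boxes_lt m n).
exists (creat q c (Unet (rows_boxes m n m))), (annih q c (Vnet (rows_boxes m n m))); split.
- move=> i j k l; have := congr1 (fun u => (c^-1 * q ^- i * (c^-1 * q ^- j)) *: u) (hR i j k l).
  rewrite !scalerDr /creat -!(scalerAl, scalerAr) !scalerA.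
  by move=> E; etransitivity; [|etransitivity; [exact: E|]]; congr (_ *: _ + _ *: _); ring.
- by move=> i j k b im jm kn bn; apply: (wick q0 c0 cq hX hU); lia.
- by move=> i k im kn; rewrite -[LHS]/(_ *: (_ vacuum)) network_vacuum // scaler0.
move=> i k; apply: adjointZ.
  by rewrite rmorphM !fmorphV /= q_conj // osc_weight_conj.
by apply: network_adjoint_pair; exact: uniq_rows_boxes.
Qed.

End FockModel.

(** * Representing the algebra and its 1-forms *)

Section OrdinalSwap.
Context {K : fieldType}.
Variable (q : K).
Hypothesis q0 : q != 0.

Definition rswap_ord {W : lmodType K} N (phi : 'I_N -> 'I_N -> W) (i j : 'I_N) : W :=
  qdiag q (i == j) *: phi i j + qoff q (i == j) *: \sum_(l < N | (l < j)%N) phi l l.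

Lemma rswap_ordE (W : lmodType K) N (phi : nat -> nat -> W) (i j : 'I_N) :
  rswap q phi i j = rswap_ord (fun i' j' : 'I_N => phi i' j') i j.
Proof. by rewrite /rswap (big_ord_widen N (fun l => phi l l)) // ltnW. Qed.

Lemma eq_rswap (W : lmodType K) N (phi psi : 'I_N -> 'I_N -> W) i j :
  phi =2 psi -> rswap_ord phi i j = rswap_ord psi i j.
Proof.
by move=> eqp; rewrite /rswap_ord eqp; congr (_ + _ *: _); apply: eq_bigr.
Qed.

Lemma rswap_low (W : lmodType K) N (phi : 'I_N -> 'I_N -> W) (i j : 'I_N) :
    (forall l : 'I_N, (l < i)%N -> phi l l = 0) ->
  rswap_ord phi i j = qdiag q (i == j) *: phi i j.
Proof.
rewrite /rswap_ord; case: eqVneq => [->|_] phi0; last by rewrite scale0r addr0.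
by rewrite big1 ?scaler0 ?addr0 // => l /phi0.
Qed.

(** Each sum over the entries of R has at most two terms, a diagonal one and, for
    a < b, a flip; the latter cancels the triangular part of [rswap_ord]. *)
Lemma rswap_Rmx (W : lmodType K) N (a b k : 'I_N) (phi : 'I_N -> W) :
  \sum_(a' < N) \sum_(b' < N) Rmx q b a b' a' *:
     rswap_ord (fun k' b'' => (k' == a')%:R *: phi b'') k b' = (k == a)%:R *: phi b.
Proof.
have sumR (F : 'I_N -> 'I_N -> W) : \sum_a' \sum_b' Rmx q b a b' a' *: F a' b' =
    (if a == b then q^-1 else 1) *: F a b + (if (a < b)%N then q^-1 - q else 0) *: F b a.
  have sum1 (c : K) i j : \sum_a' \sum_b'
      (c *+ ((a' == i) && (b' == j))) *: F a' b' = c *: F i j.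
    rewrite (bigD1 i) //= [X in _ + X]big1 ?addr0 => [|l /negPf ne_l].
      rewrite (bigD1 j) //= [X in _ + X]big1 ?addr0 ?eqxx // => l /negPf ne_l.
      by rewrite ne_l andbF mulr0n scale0r.
    by rewrite big1 // => l' _; rewrite ne_l mulr0n scale0r.
  rewrite -!sum1 -big_split; apply: eq_bigr => a' _.
  rewrite -big_split; apply: eq_bigr => b' _.
  by rewrite RmxE scalerDl.
have SqE a' b' : rswap_ord (fun k' b'' => (k' == a')%:R *: phi b'') k b' =
    (qdiag q (k == b') * (k == a')%:R) *: phi b' + (qoff q (k == b') * (a' < b')%N%:R) *: phi a'.
  rewrite /rswap_ord scalerA; congr (_ + _); rewrite -scalerA; congr (_ *: _).
  rewrite big_mkcond (bigD1 a') //= big1 ?addr0 => [|l /negPf->]; last by rewrite scale0r if_same.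
  by rewrite eqxx scale1r; case: ifP; rewrite ?scale1r ?scale0r.
rewrite sumR !SqE; have [<-|ab] := eqVneq a b.
  rewrite ltnn mulr0 scale0r addr0 scale0r addr0 scalerA.
  by case: (k == a); rewrite /= ?mulr1 ?mulVf // !mulr0.
rewrite scale1r; have [lab|] := boolP (a < b)%N; last first.
  rewrite mulr0 !scale0r !addr0 => _; congr (_ *: _).
  by have [->|_] := eqVneq k a; rewrite ?mulr0 // (negPf ab) mulr1.
rewrite (_ : (b < a)%N = false); last by apply/negbTE; rewrite -leqNgt ltnW.
rewrite mulr0 scale0r addr0 scalerA; have [->|ka] := eqVneq k a.
  by rewrite (negPf ab) /qdiag /qoff /= !(mulr0, mulr1, mul0r, scale0r, addr0).
rewrite /qdiag /qoff !mulr0 !scale0r add0r mulr1 mul1r -scalerDl.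
by case: (k == b); rewrite ?mulr1 ?mulr0 ?addr0 ?scale0r // -[q^-1 - q]opprB addrN scale0r.
Qed.
End OrdinalSwap.
Section Representation.
Context {K : numClosedFieldType} {I : eqType}.
Variables (q : K) (m n : nat).
Hypothesis hq : 0 < q < 1.
Variables (Z D : 'I_m -> 'I_n -> endo K I) (Om : fock K I).
Hypothesis ZR : forall (i j : 'I_m) (k l : 'I_n),
  qdiag q (i == j) *: (Z i k * Z j l) + qoff q (i < j)%N *: (Z j k * Z i l) =
  qdiag q (k == l) *: (Z j l * Z i k) + qoff q (l < k)%N *: (Z j k * Z i l).
Hypothesis DZ : forall i j k b, D i k * Z j b =
  rswap_ord q (fun i' j' => rswap_ord q (fun k' b' => Z j' b' * D i' k') k b) i j +
    ((i == j) && (k == b))%:R.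
Hypothesis DOm : forall i k, D i k Om = 0.
Hypothesis Om0 : Om != 0.

Local Notation A := (qMat q m n).
Local Notation z := (zgen q).

Let q0 : q != 0. Proof. by case/andP: hq => /gt_eqF->. Qed.
Let qW := @qmatW K q m n.
Let oW := @omegaW K q m n.

(** Products are reversed: right multiplications compose in the opposite order. *)
Fixpoint eval_term (t : @qterm K m n) : endo K I := match t with
  | QZ al a => Z al a
  | QScal c => c%:A
  | QAdd x y => eval_term x + eval_term y
  | QMul x y => eval_term y * eval_term x
  end.

Lemma eval_cong x y : qcong q x y -> eval_term x = eval_term y.
Proof.
elim=> //= {x y}.
- by move=> y x t _ -> _ ->.
- by move=> x x' y y' _ -> _ ->.
- by move=> x x' y y' _ -> _ ->.
- by move=> *; rewrite addrA.
- by move=> *; rewrite addrC.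
- by move=> *; rewrite scale0r add0r.
- by move=> x; rewrite scaleN1r mulrN1 addNr scale0r.
- by move=> *; rewrite mulrA.
- by move=> *; rewrite scale1r mulr1.
- by move=> *; rewrite scale1r mul1r.
- by move=> *; rewrite mulrDr.
- by move=> *; rewrite mulrDl.
- by move=> *; rewrite scalerDl.
- by move=> c e; rewrite -scalerAl mul1r scalerA mulrC.
- by move=> c x; rewrite -scalerAl -scalerAr mul1r mulr1.
- move=> al be a b [[<- lt]|[lt <-]]; rewrite -scalerAr mulr1.
    have := ZR be al a a; rewrite !eqxx ltnn /= (ltnNge be) (ltnW lt) /= -val_eqE /= (gtn_eqF lt).
    by rewrite /qdiag /qoff !scale0r !addr0 scale1r.
  have := ZR al al a b; rewrite eqxx ltnn /= (ltnNge b) (ltnW lt) /= -val_eqE /= (ltn_eqF lt).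
  by rewrite /qdiag /qoff !scale0r !addr0 scale1r.
- move=> al be a b lt lt'; have := ZR al be a b.
  rewrite (ltnNge al) (ltnW lt') (ltnNge b) (ltnW lt) -!val_eqE /= (ltn_eqF lt) (gtn_eqF lt').
  by rewrite /qdiag /qoff !scale0r !addr0 !scale1r.
- move=> al be a b lt lt'; have := ZR be al b a.
  rewrite (ltnNge be) (ltnW lt') lt -!val_eqE /= (gtn_eqF lt) (gtn_eqF lt').
  by rewrite /qdiag /qoff !scale0r !addr0 !scale1r -scalerAr mulr1.
Qed.

Definition Phi (f : A) : fock K I := eval_term (repr f) Om.

Lemma Phi_of t : Phi (qmat_of q t) = eval_term t Om.
Proof. by rewrite /Phi (eval_cong (repr_qmat_of q t)). Qed.

Lemma PhiD f g : Phi (f + g) = Phi f + Phi g.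
Proof. by elim/qW: f => x; elim/qW: g => y; rewrite -qmat_ofD !Phi_of. Qed.

Lemma PhiZ c f : Phi (c *: f) = c *: Phi f.
Proof.
elim/qW: f => x; rewrite -mulr_algl -qmat_of_scal -qmat_ofM !Phi_of /=.
by rewrite endoZ.
Qed.

Lemma Phi1 : Phi 1 = Om.
Proof. by rewrite -[1]scale1r -qmat_of_scal Phi_of /= scale1r. Qed.

Lemma Phi0 : Phi 0 = 0.
Proof. by rewrite -[0](scale0r (1 : A)) PhiZ scale0r. Qed.

Lemma PhiN f : Phi (- f) = - Phi f.
Proof. by rewrite -scaleN1r PhiZ scaleN1r. Qed.

Lemma Phi_sum J (r : seq J) (P : pred J) (F : J -> A) :
  Phi (\sum_(j <- r | P j) F j) = \sum_(j <- r | P j) Phi (F j).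
Proof. exact: (big_morph _ PhiD Phi0). Qed.

Lemma Phi_mulz f j b : Phi (f * z j b) = Z j b (Phi f).
Proof. by elim/qW: f => x; rewrite -qmat_ofM !Phi_of. Qed.

Lemma qMat_rind (P : A -> Prop) : P 1 -> (forall c f, P f -> P (c *: f)) ->
    (forall f g, P f -> P g -> P (f + g)) ->
    (forall f j b, P f -> P (f * z j b)) -> forall f, P f.
Proof.
move=> P1 PZ PD PM; elim/qW => t; rewrite -[qmat_of q t]mul1r.
elim: t 1 P1 => [j b|c|x IHx y IHy|x IHx y IHy] f Pf.
- exact: PM.
- by rewrite qmat_of_scal mulr_algr; exact: PZ.
- by rewrite qmat_ofD mulrDr; apply: PD; [exact: IHx|exact: IHy].
- by rewrite qmat_ofM mulrA; apply/IHy/IHx.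
Qed.

(** The lexicographic order of the generators.  All the annihilators on the
    right-hand side of the Wick relation at (i, k) come before (i, k), except for
    the one at (i, k) itself. *)
Definition key (j : 'I_m) (b : 'I_n) := (b * m + j)%N.

(** The span of the words in the generators from position t on.  The words are not
    normally ordered, so that closure under right multiplication is immediate. *)
Inductive above (t : nat) : A -> Prop :=
  | above_one : above t 1
  | above_scale c f : above t f -> above t (c *: f)
  | above_add f g : above t f -> above t g -> above t (f + g)
  | above_mul f j b : (t <= key j b)%N -> above t f -> above t (f * z j b).

Lemma above0 t : above t 0.
Proof. by rewrite -(scale0r (1 : A)); apply/above_scale/above_one. Qed.

Lemma above_all f : above 0 f.
Proof.
elim/qMat_rind: f => [|c f|f g|f j b]; [exact: above_one|exact: above_scale|exact: above_add|].
exact: above_mul.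
Qed.

Lemma above_const f : above (n * m) f -> exists c : K, f = c%:A.
Proof.
elim=> [|c g _ [e ->]|g h _ [e ->] _ [e' ->]|g j b].
- by exists 1; rewrite scale1r.
- by exists (c * e); rewrite scalerA.
- by exists (e + e'); rewrite scalerDl.
rewrite leqNgt => /negP[]; rewrite /key; have := ltn_ord j; have := ltn_ord b; nia.
Qed.

Lemma rswap_endo N (phi : 'I_N -> 'I_N -> endo K I) i j f :
  rswap_ord q phi i j f = rswap_ord q (fun i' j' => phi i' j' f) i j.
Proof.
rewrite /rswap_ord -[LHS]/(_ *: phi i j f + _ *: (\sum_(l < N | (l < j)%N) phi l l) f).
by rewrite endo_sumE.
Qed.

(** On a vector killed by all the earlier annihilators, the Wick relation reduces
    to that of a single q-oscillator. *)
Lemma wick_low (i j : 'I_m) (k b : 'I_n) f :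
    (forall (i' : 'I_m) (k' : 'I_n), (i' <= i)%N -> (k' <= k)%N ->
      (i', k') != (i, k) -> D i' k' f = 0) ->
  D i k (Z j b f) = (qdiag q (i == j) * qdiag q (k == b)) *: Z j b (D i k f) +
    ((i == j) && (k == b))%:R *: f.
Proof.
move=> D0; rewrite -[LHS]/((D i k * Z j b) f) DZ -[LHS]/(_ f + _ f).
congr (_ + _); last by case: (_ && _); rewrite ?scale1r ?scale0r.
rewrite rswap_endo rswap_low => [|l li]; last first.
  rewrite rswap_endo rswap_low => [|l' lk]; first rewrite -[_ (_ * _) _]/(Z l b (D l k f)).
    by rewrite D0 ?(ltnW li) ?endo0 ?scaler0 // xpair_eqE -val_eqE (ltn_eqF li).
  rewrite -[LHS]/(Z l l' (D l l' f)) D0 ?endo0 ?(ltnW li) ?(ltnW lk) //.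
  by rewrite xpair_eqE -val_eqE (ltn_eqF li).
rewrite rswap_endo rswap_low => [|l lk]; last first.
  rewrite -[LHS]/(Z j l (D i l f)) D0 ?endo0 ?(ltnW lk) //.
  by rewrite xpair_eqE -!val_eqE (ltn_eqF lk) andbF.
by rewrite scalerA.
Qed.

Lemma key_le (i i' : 'I_m) (k k' : 'I_n) : (i' <= i)%N -> (k' <= k)%N -> (i', k') != (i, k) ->
  (key i' k' < key i k)%N.
Proof.
rewrite xpair_eqE -!val_eqE /key /= => ii kk.
have [-> ne|kne _] := eqVneq (val k') k.
  by rewrite ltn_add2l ltn_neqAle ii andbT; move: ne; rewrite andbT.
have : (k'.+1 * m <= k * m)%N by rewrite leq_mul2r ltn_neqAle kne kk orbT.
by have := ltn_ord i'; rewrite mulSn; lia.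
Qed.

Lemma key_inj (i i' : 'I_m) (k k' : 'I_n) :
  key i k = key i' k' -> i = i' /\ k = k'.
Proof.
rewrite /key => e; have := ltn_ord i'; have := ltn_ord i => ? ?.
have ek : k = k' :> nat by nia.
by split; apply/val_inj => //=; move: e; rewrite ek => /addnI.
Qed.

Lemma above_annih t f : above t f ->
  forall i k, (key i k < t)%N -> D i k (Phi f) = 0.
Proof.
elim=> [|c g _ IHg|g h _ IHg _ IHh|g j b tjb _ IHg] i k ikt.
- by rewrite Phi1 DOm.
- by rewrite PhiZ endoZ IHg ?scaler0.
- by rewrite PhiD endoD IHg ?IHh ?addr0.
rewrite Phi_mulz wick_low => [|i' k' ii kk ne]; last first.
  by apply: IHg; exact: ltn_trans (key_le ii kk ne) ikt.
rewrite IHg // endo0 scaler0 add0r; case: andP => [[/eqP ij /eqP kb]|_]; last by rewrite scale0r.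
by move: ikt; rewrite ij kb ltnNge tjb.
Qed.

Section Stage.
Variables (j : 'I_m) (b : 'I_n).
Local Notation t := (key j b).
Local Notation w := (z j b).

(** Left polynomials of degree less than J in w, with coefficients spanned by words
    in the generators after w. *)
Fixpoint stage J f := match J with
  | 0%N => f = 0
  | J'.+1 => exists g h, [/\ stage J' g, above t.+1 h & f = g + h * w ^+ J'] end.

Lemma stage0 J : stage J 0.
Proof.
by elim: J => //= J IHJ; exists 0, 0; split=> //; [exact: above0|rewrite mul0r addr0].
Qed.

Lemma stageD J f g : stage J f -> stage J g -> stage J (f + g).
Proof.
elim: J f g => [|J IHJ] f g /=; first by move=> -> ->; rewrite addr0.
move=> [f1 [h1 [s1 a1 ->]]] [f2 [h2 [s2 a2 ->]]]; exists (f1 + f2), (h1 + h2).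
by split; [exact: IHJ|exact: above_add|rewrite mulrDl addrACA].
Qed.

Lemma stageZ J c f : stage J f -> stage J (c *: f).
Proof.
elim: J f => [|J IHJ] f /=; first by move=> ->; rewrite scaler0.
move=> [g [h [s a ->]]]; exists (c *: g), (c *: h).
by split; [exact: IHJ|exact: above_scale|rewrite -scalerAl scalerDr].
Qed.

Lemma stageS J f : stage J f -> stage J.+1 f.
Proof. by move=> s; exists f, 0; split=> //; [exact: above0|rewrite mul0r addr0]. Qed.

Lemma stage_mulw J f : stage J f -> stage J.+1 (f * w).
Proof.
elim: J f => [|J IHJ] f; first by move=> ->; rewrite mul0r; exact: stage0.
move=> [g [h [s a ->]]]; exists (g * w), h.
by split=> //; [exact: IHJ|rewrite mulrDl -mulrA -exprSr].
Qed.

Lemma stage_mon h J : above t.+1 h -> stage J.+1 (h * w ^+ J).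
Proof. by move=> a; exists 0, h; split=> //; [exact: stage0|rewrite add0r]. Qed.

(** When w is exchanged with a later generator, the correction term of the cross
    relation involves only generators after w. *)
Lemma swap_z i k : (t < key i k)%N -> exists c e i1 k1 i2 k2,
  [/\ w * z i k = c *: (z i k * w) + e *: (z i1 k1 * z i2 k2),
      (t < key i1 k1)%N & (t < key i2 k2)%N].
Proof.
move=> tik.
have rel (x y : @qterm K m n) : qcong q x y -> qmat_of q x = qmat_of q y.
  by move/qmat_of_eqP.
have [bk|kb|bk] := ltngtP b k.
- have [ji|ij|ji] := ltngtP j i.
  + exists 1, (q - q^-1), i, b, j, k; split.
    * have := rel _ _ (qcong_rel_cross q bk ji).
      by rewrite qmat_ofD !qmat_ofM qmat_of_scal mulr_algl scale1r.
    * by rewrite /key ltn_add2l.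
    * by rewrite /key; have := ltn_ord j; nia.
  + exists 1, 0, i, k, i, k; split=> //; rewrite scale0r addr0 scale1r.
    by have := rel _ _ (qcong_rel_comm q bk ij); rewrite !qmat_ofM.
  + exists q, 0, i, k, i, k; split=> //; rewrite scale0r addr0.
    have := rel _ _ (qcong_rel_q q (or_intror (conj bk (val_inj ji)))).
    by rewrite !qmat_ofM qmat_of_scal mulr_algl.
- by move: tik; rewrite /key; have := ltn_ord j; have := ltn_ord i; nia.
have {}bk := val_inj bk; exists q, 0, i, k, i, k; split=> //; rewrite scale0r addr0.
have ji : (j < i)%N by move: tik; rewrite /key bk ltn_add2l.
have := rel _ _ (qcong_rel_q q (or_introl (conj bk ji))).
by rewrite !qmat_ofM qmat_of_scal mulr_algl.
Qed.

(** In h w^J z the factor z is moved to the left of one w at a time; neither the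
    exchange nor the correction term raises the degree in w. *)
Lemma stage_mulz J f i k : (t < key i k)%N -> stage J f -> stage J (f * z i k).
Proof.
elim: J f i k => [|J IHJ] f i k tik; first by move=> /= ->; rewrite mul0r.
move=> [g [h [sg ah ->]]]; rewrite mulrDl; apply: stageD; first exact/stageS/IHJ.
case: J IHJ {sg} => [|J] IHJ.
  by rewrite expr0 mulr1 -[h * z i k]mulr1 -[1](expr0 w); apply/stage_mon/above_mul.
have [c [e [i1 [k1 [i2 [k2 [sw t1 t2]]]]]]] := swap_z tik.
rewrite exprSr -!mulrA sw mulrA mulrDr -!scalerAr; have sh := stage_mon J ah.
apply: stageD; apply: stageZ; rewrite mulrA; first exact/stage_mulw/IHJ.
exact/stageS/IHJ/IHJ.
Qed.

Lemma above_stage f : above t f -> exists J, stage J f.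
Proof.
elim=> [|c g _ [J s]|g h _ [J s] _ [J' s']|g i k tik _ [J s]].
- by exists 1%N; have := stage_mon 0 (above_one _); rewrite expr0 mulr1.
- by exists J; exact: stageZ.
- exists (J' + J)%N; apply: stageD.
    by elim: J' {s'} => //= J' IHJ; exact: stageS.
  by elim: J {s} => [|J IHJ]; rewrite ?addn0 // addnS; exact: stageS.
move: tik; rewrite leq_eqVlt => /orP[/eqP/key_inj[<- <-]|tik].
  by exists J.+1; exact: stage_mulw.
by exists J; exact: stage_mulz.
Qed.

Lemma above_mulw h J : above t.+1 h -> above t (h * w ^+ J).
Proof.
move=> a; elim: J => [|J IHJ]; last by rewrite exprSr mulrA; apply: above_mul.
rewrite expr0 mulr1; elim: a => [|c f _|f g _ IHf _|f i k tik _].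
- exact: above_one.
- exact: above_scale.
- exact: above_add.
- exact/above_mul/ltnW.
Qed.

Definition qnum J : K := \sum_(l < J) q ^+ 2 ^+ l.

Lemma qnumS_neq0 J : qnum J.+1 != 0.
Proof.
rewrite /qnum big_ord_recl expr0 gt_eqF // ltr_wpDr ?ltr01 //.
apply: sumr_ge0 => l _; do 2!apply: exprn_ge0; by case/andP: hq => /ltW.
Qed.

Lemma annih_mon h J : above t.+1 h -> D j b (Phi (h * w ^+ J)) = qnum J *: Phi (h * w ^+ J.-1).
Proof.
move=> a; elim: J => [|J IHJ].
  by rewrite /qnum big_ord0 scale0r expr0 mulr1 (above_annih a).
rewrite exprSr mulrA Phi_mulz wick_low => [|i' k' ii kk ne]; last first.
  exact: (above_annih (above_mulw J a)) (key_le ii kk ne).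
rewrite !eqxx /= -expr2 IHJ scale1r /qnum big_ord_recl expr0 endoZ -Phi_mulz -mulrA -exprSr.
case: J {IHJ} => [|J]; first by rewrite !big_ord0 scale0r scaler0 add0r addr0 scale1r.
rewrite /= scalerA -[X in _ + X]scale1r -scalerDl; congr (_ *: _).
by rewrite addrC mulr_sumr; congr (_ + _); apply: eq_bigr => l _; rewrite -exprS.
Qed.

Let iter0 l : iter l (D j b) 0 = 0.
Proof. by elim: l => //= l ->; rewrite endo0. Qed.

Let iterD l f g : iter l (D j b) (f + g) = iter l (D j b) f + iter l (D j b) g.
Proof. by elim: l => //= l ->; rewrite endoD. Qed.

Let iterZ l (c : K) f : iter l (D j b) (c *: f) = c *: iter l (D j b) f.
Proof. by elim: l => //= l ->; rewrite endoZ. Qed.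

Lemma iter_annih_mon_lt h J l : above t.+1 h -> (J < l)%N ->
  iter l (D j b) (Phi (h * w ^+ J)) = 0.
Proof.
move=> a; elim: J l => [|J IHJ] [|l] // Jl; rewrite iterSr annih_mon // iterZ.
  by rewrite /qnum big_ord0 scale0r.
by rewrite IHJ ?scaler0.
Qed.

Lemma iter_annih_mon h J : above t.+1 h ->
  exists2 c, c != 0 & iter J (D j b) (Phi (h * w ^+ J)) = c *: Phi h.
Proof.
move=> a; elim: J => [|J [c c0 IHJ]].
  by exists 1; rewrite ?oner_eq0 // expr0 mulr1 scale1r.
exists (qnum J.+1 * c); first by rewrite mulf_neq0 ?qnumS_neq0.
by rewrite iterSr annih_mon // iterZ IHJ scalerA.
Qed.

Lemma iter_annih_stage J f l : stage J f -> (J <= l)%N -> iter l (D j b) (Phi f) = 0.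
Proof.
elim: J f l => [|J IHJ] f l /=.
  by move=> -> _; rewrite Phi0 iter0.
move=> [g [h [sg ah ->]]] Jl.
by rewrite PhiD iterD IHJ ?(ltnW Jl) // iter_annih_mon_lt // addr0.
Qed.

(** The J-th iterate of the annihilator at w kills all the terms of degree less
    than J and multiplies the leading coefficient by a nonzero q-factorial. *)
Lemma stage_Phi_eq0 J f : (forall h, above t.+1 h -> Phi h = 0 -> h = 0) ->
  stage J f -> Phi f = 0 -> f = 0.
Proof.
move=> inj; elim: J f => [//|J IHJ] f /= [g [h [sg ah ->]]] Phif.
have h0 : h = 0.
  apply: inj => //; have [c c0 eqh] := iter_annih_mon J ah.
  apply/eqP; rewrite -(inj_eq (scalerI c0)) scaler0 -eqh.
  have := congr1 (iter J (D j b)) Phif; rewrite PhiD iterD (iter_annih_stage sg) // add0r => ->.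
  by rewrite iter0.
by move: Phif; rewrite h0 mul0r addr0; exact: IHJ.
Qed.

End Stage.

Lemma Phi_eq0 f : Phi f = 0 -> f = 0.
Proof.
(* Downward induction on the position from which generators are allowed. *)
suff H d : (d <= n * m)%N -> forall f, above (n * m - d) f -> Phi f = 0 -> f = 0.
  by apply: (H (n * m)%N) => //; rewrite subnn; exact: above_all.
elim: d => [_ g|d IHd dnm g ag].
  rewrite subn0 => /above_const[c ->]; rewrite PhiZ Phi1 => /eqP.
  by rewrite scaler_eq0 (negPf Om0) orbF => /eqP->; rewrite scale0r.
have m0 : (0 < m)%N by case: (posnP m) dnm => // ->; rewrite muln0.
have jm : ((n * m - d.+1) %% m < m)%N by rewrite ltn_mod.
have bn : ((n * m - d.+1) %/ m < n)%N by rewrite ltn_divLR //; lia.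
pose j := Ordinal jm; pose b := Ordinal bn.
have ke : key j b = (n * m - d.+1)%N by rewrite /key /= -divn_eq.
rewrite -ke in ag; have [J sJ] := above_stage ag.
apply: stage_Phi_eq0 sJ => h; rewrite ke (_ : (n * m - d.+1).+1 = n * m - d)%N; last by lia.
by apply: IHd; lia.
Qed.

Lemma Phi_inj : injective Phi.
Proof.
move=> f g fg; apply/eqP; rewrite -subr_eq0; apply/eqP/Phi_eq0.
by rewrite PhiD PhiN fg subrr.
Qed.

(** The coordinates of a 1-form multiplied by a generator on the right. *)
Definition right_z j b (g : 'M[A]_(m, n)) : 'M[A]_(m, n) := \matrix_(i, k)
  rswap_ord q (fun i' j' => rswap_ord q (fun k' b' => g i' k' * z j' b') k b) i j.

Lemma Phi_right_z j b (g : 'M[A]_(m, n)) f i k :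
  (forall i k, D i k (Phi f) = Phi (g i k)) ->
  D i k (Phi (f * z j b)) = Phi ((right_z j b g + f *: delta_mx j b) i k).
Proof.
move=> Dg; rewrite Phi_mulz -[LHS]/((D i k * Z j b) (Phi f)) DZ.
rewrite -[LHS]/(_ (Phi f) + _ (Phi f)) !mxE PhiD; congr (_ + _); last first.
  case: (_ && _); rewrite ?mulr1 ?mulr0 ?Phi0 -?[LHS]/(_ *: Phi f) //.
have PhiS N (phi : 'I_N -> 'I_N -> A) a c :
    Phi (rswap_ord q phi a c) = rswap_ord q (fun a c => Phi (phi a c)) a c.
  by rewrite /rswap_ord PhiD !PhiZ Phi_sum.
rewrite rswap_endo PhiS; apply: eq_rswap => i' j'.
rewrite rswap_endo PhiS; apply: eq_rswap => k' b'.
by rewrite Phi_mulz -Dg.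
Qed.

Lemma grad_exists f : exists g : 'M[A]_(m, n), forall i k, D i k (Phi f) = Phi (g i k).
Proof.
elim/qMat_rind: f => [|c f [g Dg]|f f' [g Dg] [g' Dg']|f j b [g Dg]].
- by exists 0 => i k; rewrite Phi1 DOm mxE Phi0.
- by exists (c%:A *: g) => i k; rewrite PhiZ endoZ Dg mxE mulr_algl PhiZ.
- by exists (g + g') => i k; rewrite PhiD endoD Dg Dg' mxE PhiD.
by exists (right_z j b g + f *: delta_mx j b) => i k; exact: Phi_right_z.
Qed.

Definition grad f : 'M[A]_(m, n) := projT1 (cid (grad_exists f)).

Lemma gradP f i k : D i k (Phi f) = Phi (grad f i k).
Proof. exact: (projT2 (cid (grad_exists f))). Qed.

Lemma grad_unique f (g : 'M[A]_(m, n)) :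
  (forall i k, D i k (Phi f) = Phi (g i k)) -> grad f = g.
Proof. by move=> Dg; apply/matrixP => i k; apply: Phi_inj; rewrite -gradP. Qed.

Lemma grad_mulz f j b : grad (f * z j b) = right_z j b (grad f) + f *: delta_mx j b.
Proof. by apply: grad_unique => i k; apply: Phi_right_z => i' k'; exact: gradP. Qed.

Lemma gradD f g : grad (f + g) = grad f + grad g.
Proof. by apply: grad_unique => i k; rewrite PhiD endoD !gradP mxE PhiD. Qed.

Lemma gradZ c f : grad (c *: f) = c%:A *: grad f.
Proof. by apply: grad_unique => i k; rewrite PhiZ endoZ gradP mxE mulr_algl PhiZ. Qed.

Lemma grad1 : grad 1 = 0.
Proof. by apply: grad_unique => i k; rewrite Phi1 DOm mxE Phi0. Qed.

Fixpoint right_term (t : @qterm K m n) (g : 'M[A]_(m, n)) : 'M[A]_(m, n) := match t with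
  | QZ j b => right_z j b g
  | QScal c => c%:A *: g
  | QAdd x y => right_term x g + right_term y g
  | QMul x y => right_term y (right_term x g)
  end.

Lemma right_term_linear t f g h :
  right_term t (f *: g + h) = f *: right_term t g + right_term t h.
Proof.
elim: t g h => [j b|c|x IHx y IHy|x IHx y IHy] g h /=.
- have SL N (phi psi : 'I_N -> 'I_N -> A) a c :
      rswap_ord q (fun a c => f * phi a c + psi a c) a c =
      f * rswap_ord q phi a c + rswap_ord q psi a c.
    rewrite /rswap_ord big_split /= -mulr_sumr !scalerDr mulrDr -!scalerAr addrACA.
    by [].
  apply/matrixP => i k; rewrite !mxE -SL; apply: eq_rswap => i' j'; rewrite -SL.
  by apply: eq_rswap => k' b'; rewrite !mxE mulrDl mulrA.
- by rewrite scalerDr !scalerA mulr_algl mulr_algr.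
- by rewrite IHx IHy scalerDr addrACA.
- by rewrite IHx IHy.
Qed.

Lemma right_term0 t : right_term t 0 = 0.
Proof. by have := right_term_linear t (-1) 0 0; rewrite scaler0 addr0 scaleN1r addNr. Qed.

Lemma right_termD t g h : right_term t (g + h) = right_term t g + right_term t h.
Proof. by have := right_term_linear t 1 g h; rewrite !scale1r. Qed.

Lemma right_termZ t f g : right_term t (f *: g) = f *: right_term t g.
Proof. by have := right_term_linear t f g 0; rewrite right_term0 !addr0. Qed.

Lemma grad_z j b : grad (z j b) = delta_mx j b.
Proof.
rewrite -[z j b]mul1r grad_mulz grad1 -[right_z j b 0]/(right_term (QZ j b) 0).
by rewrite right_term0 add0r scale1r.
Qed.

Lemma grad_mul f t :
  grad (f * qmat_of q t) = right_term t (grad f) + f *: grad (qmat_of q t).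
Proof.
elim: t f => [j b|c|x IHx y IHy|x IHx y IHy] f /=.
- by rewrite grad_mulz grad_z.
- by rewrite qmat_of_scal mulr_algr !gradZ grad1 !scaler0 addr0.
- by rewrite qmat_ofD mulrDr !gradD IHx IHy scalerDr addrACA.
- by rewrite qmat_ofM mulrA !IHy !IHx right_termD right_termZ scalerDr scalerA addrA.
Qed.

(** By [grad_mul], the right action of t on [grad f] is the difference of
    [grad (f * t)] and [f *: grad t], which depends on the class of t only.  For f a
    generator, [grad f] runs over a basis. *)
Lemma right_cong x y g : qcong q x y -> right_term x g = right_term y g.
Proof.
move=> xy; rewrite (matrix_sum_delta g).
have big t := big_morph (right_term t) (right_termD t) (right_term0 t).
rewrite !big; apply: eq_bigr => i _; rewrite !big; apply: eq_bigr => k _.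
rewrite !right_termZ -(grad_z i k); congr (_ *: _).
apply: (addIr (z i k *: grad (qmat_of q x))); rewrite -grad_mul.
by rewrite ((qmat_of_eqP q x y).1 xy) -grad_mul.
Qed.

Definition right_act (f : A) := right_term (repr f).

Lemma right_act_of t g : right_act (qmat_of q t) g = right_term t g.
Proof. exact/right_cong/repr_qmat_of. Qed.

(** The free left module on the dz as a model of the bimodule of 1-forms. *)
Fixpoint oeval (u : oterm q m n) : 'M[A]_(m, n) := match u with
  | OZero => 0
  | ODz al a => delta_mx al a
  | OAdd u v => oeval u + oeval v
  | OLeft f u => f *: oeval u
  | ORight u f => right_act f (oeval u)
  end.

(** The two indices of R are treated one after the other, by [rswap_Rmx]. *)
Lemma right_z_rel (al be : 'I_m) (a b : 'I_n) :
  z be b *: delta_mx al a = \sum_(al' < m) \sum_(be' < m) \sum_(a' < n) \sum_(b' < n)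
    (Rmx q be al be' al' * Rmx q b a b' a')%:A *: right_z be' b' (delta_mx al' a').
Proof.
apply/matrixP => i k; rewrite !mxE summxE.
have -> : z be b * ((i == al) && (k == a))%:R = (i == al)%:R *: ((k == a)%:R *: z be b) :> A.
  by rewrite scalerA -natrM mulnb mulr_natr scaler_nat.
rewrite -(rswap_Rmx q0 al be i (fun j' => (k == a)%:R *: z j' b)).
apply: eq_bigr => al' _; rewrite summxE; apply: eq_bigr => be' _; rewrite summxE.
have SZ N (phi : 'I_N -> 'I_N -> A) c i' j' :
    c *: rswap_ord q phi i' j' = rswap_ord q (fun i' j' => c *: phi i' j') i' j'.
  by rewrite /rswap_ord scalerDr -scaler_sumr !scalerA ![c * _]mulrC.
have Ssum N M (phi : 'I_M -> 'I_N -> 'I_N -> A) i' j' :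
    rswap_ord q (fun i' j' => \sum_(l < M) phi l i' j') i' j' = \sum_l rswap_ord q (phi l) i' j'.
  by rewrite /rswap_ord exchange_big big_split -!scaler_sumr.
under [RHS]eq_bigr => a' _.
  rewrite summxE; under eq_bigr => b' _ do rewrite !mxE mulr_algl -scalerA SZ.
  rewrite -scaler_sumr -Ssum; over.
rewrite -scaler_sumr -Ssum; congr (_ *: _); apply: eq_rswap => i' j'.
rewrite -(rswap_Rmx q0 a b k (fun b' => z j' b')) scaler_sumr; apply: eq_bigr => a' _.
rewrite scaler_sumr; apply: eq_bigr => b' _; rewrite scalerA mulrC -scalerA; congr (_ *: _).
rewrite SZ; apply: eq_rswap => k' b''; rewrite !mxE.
by rewrite scalerA -natrM mulnb mulr_natl scaler_nat.
Qed.

Lemma oeval_cong u v : ocong u v -> oeval u = oeval v.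
Proof.
elim=> //= {u v}.
- by move=> v u w _ -> _ ->.
- by move=> u u' v v' _ -> _ ->.
- by move=> f u u' _ ->.
- by move=> f u u' _ ->.
- by move=> *; rewrite addrA.
- by move=> *; rewrite addrC.
- by move=> *; rewrite add0r.
- by move=> u; rewrite scaleN1r addNr.
- by move=> *; rewrite scalerA.
- by move=> *; rewrite scale1r.
- by move=> *; rewrite scalerDr.
- by move=> *; rewrite scalerDl.
- by move=> f g u; elim/qW: f => x; elim/qW: g => y; rewrite -qmat_ofM !right_act_of.
- by move=> u; rewrite -[1]scale1r -qmat_of_scal right_act_of /= scale1r scale1r.
- by move=> f u v; exact: right_termD.
- by move=> f g u; elim/qW: f => x; elim/qW: g => y; rewrite -qmat_ofD !right_act_of.
- by move=> f g u; exact: right_termZ.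
- by move=> c u; rewrite -[in RHS]qmat_of_scal right_act_of.
move=> al be a b; rewrite right_z_rel.
pose om_big := big_morph oeval (fun u v => erefl (oeval (OAdd u v))) (erefl (oeval (OZero _ _ _))).
rewrite om_big; apply: eq_bigr => al' _; rewrite om_big.
apply: eq_bigr => be' _; rewrite om_big; apply: eq_bigr => a' _.
by rewrite om_big; apply: eq_bigr => b' _ /=; rewrite (right_act_of (QZ _ _)).
Qed.

Definition coords (w : Omega1 q m n) : 'M[A]_(m, n) := oeval (repr w).

Lemma coords_of u : coords (omega_of u) = oeval u.
Proof. exact/oeval_cong/repr_omega_of. Qed.

Lemma coordsD u v : coords (u + v) = coords u + coords v.
Proof. by elim/oW: u => u; elim/oW: v => v; rewrite -omega_ofD !coords_of. Qed.

Lemma coords0 : coords 0 = 0.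
Proof. by rewrite -omega_of0 coords_of. Qed.

Lemma coordsZ f u : coords (f *: u) = f *: coords u.
Proof. by elim/oW: u => u; rewrite -omega_of_left !coords_of. Qed.

Lemma coords_rmul u t : coords (rmul u (qmat_of q t)) = right_term t (coords u).
Proof.
by elim/oW: u => u; rewrite -omega_of_right !coords_of /= right_act_of.
Qed.

Lemma coords_dterm t : coords (dterm q t) = grad (qmat_of q t).
Proof.
elim: t => [j b|c|x IHx y IHy|x IHx y IHy] /=.
- by rewrite grad_z coords_of.
- by rewrite coords0 qmat_of_scal gradZ grad1 scaler0.
- by rewrite coordsD IHx IHy qmat_ofD gradD.
- by rewrite coordsD coords_rmul coordsZ IHx IHy qmat_ofM grad_mul.
Qed.

(** The model [oeval] shows that the coefficients of a 1-form in the dz are unique,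
    so those of df are the entries of the gradient. *)
Lemma qpartialE al a f : qpartial al a f = grad f al a.
Proof.
have := congr1 coords (qgradP q0 f).
have -> : coords (qdiff f) = grad f by elim/qW: f => t; rewrite qdiff_qmat_of // coords_dterm.
move=> ->; have big := big_morph coords coordsD coords0.
have -> : coords (\sum_(al < m) \sum_(a < n) qpartial al a f *: dz q al a) =
    \sum_al \sum_a qpartial al a f *: delta_mx al a.
  rewrite big; apply: eq_bigr => i _; rewrite big; apply: eq_bigr => k _.
  by rewrite coordsZ coords_of.
rewrite summxE (bigD1 al) //= summxE (bigD1 a) //= !mxE !eqxx mulr1.
rewrite !big1 ?addr0 // => [i ia|k ka].
  by rewrite summxE big1 // => k _; rewrite !mxE [al == i]eq_sym (negPf ia) mulr0.
by rewrite !mxE [a == k]eq_sym (negPf ka) andbF mulr0.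
Qed.

Lemma Phi_qpartial al a f : Phi (qpartial al a f) = D al a (Phi f).
Proof. by rewrite qpartialE gradP. Qed.

End Representation.

(** * Existence and uniqueness of the inner product *)

Section DotOf.
Context {K : numClosedFieldType} (U : lmodType K) (F : U -> U -> K).
Hypothesis Flin : forall g c f f', F (c *: f + f') g = c * F f g + F f' g.
Hypothesis FC : forall f g, F f g = (F g f)^*.
Hypothesis Fpos : forall f, f != 0 -> 0 < F f f.

Let F_bilinear : bilinear_for *%R (Num.conj \; *%R) F.
Proof.
split=> [g c f f'|f c g g']; first exact: Flin.
by rewrite FC Flin rmorphD rmorphM /= -!FC.
Qed.

Let F_hermitian f g : F f g = (-1) ^+ false * (F g f)^*.
Proof. by rewrite expr0 mul1r -FC. Qed.

HB.instance Definition _ := bilinear_isBilinear.Build K U U K *%R (Num.conj \; *%R) F F_bilinear.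
HB.instance Definition _ := isHermitianSesquilinear.Build K U false Num.conj F F_hermitian.
HB.instance Definition _ := isDotProduct.Build K U F Fpos.

Lemma dot_exists : exists G : {dot U for Num.conj}, G =2 F.
Proof. by exists F. Qed.

End DotOf.

Section FockForm.
Context {K : numClosedFieldType}.
Variables (q : K) (m n : nat).
Hypothesis hq : 0 < q < 1.
Local Notation A := (qMat q m n).

Let qrind := @qMat_rind K q m n.

Lemma fock_model_ord : exists Z D : 'I_m -> 'I_n -> endo K (nat * nat)%type,
  [/\ forall (i j : 'I_m) (k l : 'I_n),
        qdiag q (i == j) *: (Z i k * Z j l) + qoff q (i < j)%N *: (Z j k * Z i l) =
        qdiag q (k == l) *: (Z j l * Z i k) + qoff q (l < k)%N *: (Z j k * Z i l),
      forall i j k b, D i k * Z j b =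
        rswap_ord q (fun i' j' => rswap_ord q (fun k' b' => Z j' b' * D i' k') k b) i j +
          ((i == j) && (k == b))%:R,
      forall i k, D i k vacuum = 0 &
      forall i k, adjoint_pair (Z i k) (D i k)].
Proof.
have [Z [D [hR hW hV hA]]] := fock_model m n hq.
exists (fun i k => Z i k), (fun i k => D i k); split=> [i j k l|i j k b|i k|i k].
- exact: hR.
- rewrite hW // rswap_ordE; congr (_ + _); apply: eq_rswap => i' j'; exact: rswap_ordE.
- exact: hV.
- exact: hA.
Qed.

Definition fock_form (F : {dot A for Num.conj}) := F 1 1 = 1 /\
  forall (P Q : A) (al : 'I_m) (a : 'I_n), F (qpartial al a P) Q = F P (Q * zgen q al a).

Lemma vacuum_neq0 : vacuum != 0 :> fock K (nat * nat)%type.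
Proof.
apply/eqP => V0; have := @dotF_vacuum K; rewrite V0 dotF0.
  by move/esym/eqP; rewrite oner_eq0.
exact: finitary0.
Qed.

Lemma fock_form_exists : exists F, fock_form F.
Proof.
have [Z [D [ZR DZ DV adj]]] := fock_model_ord.
pose Ph : A -> _ := Phi Z vacuum.
have fin f : finitary (Ph f).
  elim/qrind: f => [|c f ff|f g ff fg|f j b ff]; rewrite /Ph.
  - by rewrite (Phi1 _ ZR); exact: vacuum_finitary.
  - by rewrite (PhiZ _ ZR); exact: finitaryZ.
  - by rewrite (PhiD _ ZR); exact: finitaryD.
  - by rewrite (Phi_mulz _ ZR); case: (adj j b) => + _ _; apply.
have [|||G GE] := @dot_exists _ A (fun f g => dotF (Ph f) (Ph g)).
- by move=> g c f f'; rewrite /Ph (PhiD _ ZR) (PhiZ _ ZR) dotF_linear.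
- by move=> f g; exact: dotFC.
- move=> f f0; apply: dotF_gt0 => //; apply: contra_neq f0.
  exact: (Phi_eq0 hq ZR DZ DV vacuum_neq0).
exists G; split=> [|P Q al a]; rewrite !GE.
  by rewrite /Ph (Phi1 _ ZR) dotF_vacuum.
rewrite /Ph (Phi_mulz _ ZR) (Phi_qpartial hq ZR DZ DV vacuum_neq0).
have [fZ fD ZD] := adj al a.
by rewrite (dotFC (fD _ (fin P)) (fin Q)) -ZD // -dotFC //; exact: fZ.
Qed.

Lemma qpartial1 al a : qpartial al a (1 : A) = 0.
Proof.
have [Z [D [ZR DZ DV _]]] := fock_model_ord.
by rewrite (qpartialE hq ZR DZ DV vacuum_neq0) (grad1 hq ZR DZ DV vacuum_neq0) mxE.
Qed.

(** The values at (P, 1) come from those at (1, P) by symmetry, and vanish on multiples of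
    the generators because 1 has zero derivatives; the others are reduced to them
    by differentiating P. *)
Lemma fock_form_unique F G : fock_form F -> fock_form G -> F = G.
Proof.
move=> fF fG; apply: dot_ext.
have const0 (H : {dot A for Num.conj}) P j b : fock_form H -> H (P * zgen q j b) 1 = 0.
  case=> _ HD; rewrite hermC expr0 mul1r.
  have H0 : H 1 (P * zgen q j b) = 0 by rewrite -HD qpartial1 linear0l.
  exact: etrans (congr1 Num.conj H0) (rmorph0 _).
have lZ (H : {dot A for Num.conj}) c f g : H (c *: f) g = c * H f g by exact: linearZl_LR.
have lD (H : {dot A for Num.conj}) f f' g : H (f + f') g = H f g + H f' g by exact: linearDl.
have rZ (H : {dot A for Num.conj}) c f g : H f (c *: g) = c^* * H f g by exact: linearZr_LR.
have rD (H : {dot A for Num.conj}) f g g' : H f (g + g') = H f g + H f g' by exact: linearDr.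
have FG1 P : F P 1 = G P 1.
  elim/qrind: P => [|c P IHP|P P' IHP IHP'|P j b _].
  - by case: fF fG => -> _ [-> _].
  - by rewrite !lZ IHP.
  - by rewrite !lD IHP IHP'.
  - by rewrite !const0.
move=> P Q; elim/qrind: Q P => [|c Q IHQ|Q Q' IHQ IHQ'|Q j b IHQ] P.
- exact: FG1.
- by rewrite !rZ IHQ.
- by rewrite !rD IHQ IHQ'.
by case: fF fG => _ FD [_ GD]; rewrite -FD -GD IHQ.
Qed.

End FockForm.

Local Open Scope complex_scope.

Theorem theorem2p1 (R : realType) (q : R) (m n : nat) (hq : 0 < q < 1) :
  exists! F : {dot (qMat q%:C m n) for Num.conj},
    F 1 1 = 1 /\
    forall (P Q : qMat q%:C m n) (al : 'I_m) (a : 'I_n),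
      F (qpartial al a P) Q = F P (Q * zgen q%:C al a).
Proof.
have hqC : 0 < q%:C < 1 by rewrite -[0]/(0%:C) -[1]/(1%:C) !ltcR.
have [F fF] := fock_form_exists m n hqC.
by exists F; split=> // G fG; exact: (fock_form_unique hqC).
Qed.
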